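(* Let $\Gamma$ be a graph and let $\Delta\leq \Gamma^{\mathrm{ext}}_k$ be a finite induced subgraph. Assume the following: (1) The vertices of $\Delta$ correspond to pairwise disjoint cliques of $\Gamma^{\mathrm{ext}}$. (2) For every induced square $S$ of $\Gamma^{\mathrm{ext}}$, at least one of the following holds: some vertex of $S$ is not in any clique corresponding to a vertex of $\Delta$; or no edge of $S$ belongs to a clique corresponding to a vertex of $\Delta$. Then there exists an integer $M>0$ with the following property: for any family $(g_K)_{K\in V(\Delta)}$ of elements of $A(\Gamma)$ such that $\mathrm{supp}(g_K)=P_K$ for all $K\in V(\Delta)$, the map $V(\Delta)\to A(\Gamma)$, $K\mapsto g_K^{M}$, extends to an injective group homomorphism $A(\Delta)\hookrightarrow A(\Gamma)$.
   Context: All graphs are simplicial (unoriented, no loops, no multi-edges), possibly infinite. An induced square is an induced cycle of length 4. $\Delta\le\Theta$ means that $\Delta$ is (embedded as) an induced subgraph of $\Theta$. An edge belongs to a clique if both its endpoints are vertices of the clique. The right-angled Artin group $A(\Gamma)$ has generating set $V(\Gamma)$ (standard generators), whose only relations are that adjacent vertices commute. For $\Theta\leq\Gamma$, $A(\Theta)$ is identified with the subgroup of $A(\Gamma)$ generated by $V(\Theta)$; a parabolic subgroup of $A(\Gamma)$ is a conjugate of some $A(\Theta)$ with $\Theta\le\Gamma$. For $g\in A(\Gamma)$, $\mathrm{supp}(g)$ is the smallest parabolic subgroup of $A(\Gamma)$ containing $g$. The extension graph $\Gamma^{\mathrm{ext}}$ has vertex set $\{gvg^{-1}\mid g\in A(\Gamma),v\in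 V(\Gamma)\}$, two vertices being adjacent iff they are distinct commuting elements of $A(\Gamma)$. The clique graph $\Theta_k$ of a graph $\Theta$ has one vertex for each non-empty finite clique of $\Theta$, two distinct cliques being adjacent iff they are contained in a common clique; $\Gamma^{\mathrm{ext}}_k$ is the clique graph of $\Gamma^{\mathrm{ext}}$. For a vertex $K$ of $\Gamma^{\mathrm{ext}}_k$ (a finite clique of $\Gamma^{\mathrm{ext}}$), $P_K$ denotes the subgroup of $A(\Gamma)$ generated by the vertices of $K$, seen as elements of $A(\Gamma)$; it is an abelian parabolic subgroup. *)

(* Defs.v *)
From HB Require Import structures.
From mathcomp Require Import all_boot generic_quotient.
From mathcomp Require Import boolp classical_sets cardinality.

Set Implicit Arguments.
Unset Strict Implicit.
Unset Printing Implicit Defensive.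

Local Open Scope classical_set_scope.
Local Open Scope group_scope.
Local Open Scope quotient_scope.

Record graph : Type := Graph {
  vertex :> Type;
  adj : vertex -> vertex -> Prop;
  adj_sym : forall x y, adj x y -> adj y x;
  adj_irrefl : forall x, ~ adj x x
}.

Section Graphs.
Variable T : graph.

Definition induced (U : set T) : graph :=
  @Graph (set_type U) (fun x y => adj (val x) (val y))
    (fun x y => @adj_sym T (val x) (val y))
    (fun x => @adj_irrefl T (val x)).

Definition induced_embedding (S : graph) (f : S -> T) : Prop :=
  injective f /\ forall x y, adj (f x) (f y) <-> adj x y.

Definition clique (K : set T) : Prop :=
  forall x y, K x -> K y -> x <> y -> adj x y.

Definition finite_cliques : set (set T) :=
  [set K | [/\ finite_set K, K !=set0 & clique K]].

Definition clique_set (K : set_type finite_cliques) : set T := val K.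

Definition clique_adj (K L : set_type finite_cliques) : Prop :=
  K <> L /\ exists C, [/\ clique C, clique_set K `<=` C & clique_set L `<=` C].

Lemma clique_adj_sym K L : clique_adj K L -> clique_adj L K.
Proof.
by move=> [neKL [C [clC KC LC]]]; split; [exact: nesym|exists C].
Qed.

Lemma clique_adj_irrefl K : ~ clique_adj K K.
Proof. by case. Qed.

Definition clique_graph : graph := Graph clique_adj_sym clique_adj_irrefl.

End Graphs.

Definition square_adj (i j : 'I_4) : Prop := j = ordS i \/ i = ordS j.

Lemma square_adj_sym i j : square_adj i j -> square_adj j i.
Proof. by case; [right|left]. Qed.

Lemma square_adj_irrefl i : ~ square_adj i i.
Proof. by case: i => -[|[|[|[|//]]]] ? [] /(congr1 val). Qed.

Definition square_graph : graph := Graph square_adj_sym square_adj_irrefl.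

Section Subgroups.
Variable G : groupType.
Implicit Types (A H : set G).

Definition is_subgroup H : Prop := group_closed [in H].

Definition generated A : set G := smallest is_subgroup A.

Definition conj_set (g : G) A : set G := [set g * x * g^-1 | x in A].

End Subgroups.

(* A(T) is the group of words in the letters v = (v, true) and               *)
(* v^-1 = (v, false), modulo the congruence generated by free cancellation    *)
(* and by the commutation of adjacent vertices.                               *)
Section Raag.
Variable T : graph.

Definition word : Type := seq (T * bool).

Inductive word_eq : word -> word -> Prop :=
| word_eq_refl w : word_eq w w
| word_eq_sym w1 w2 : word_eq w1 w2 -> word_eq w2 w1
| word_eq_trans w1 w2 w3 : word_eq w1 w2 -> word_eq w2 w3 -> word_eq w1 w3
| word_eq_cat w1 w2 w1' w2' :
    word_eq w1 w1' -> word_eq w2 w2' -> word_eq (w1 ++ w2) (w1' ++ w2')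
| word_eq_cancel v b : word_eq [:: (v, b); (v, ~~ b)] [::]
| word_eq_comm u v :
    adj u v -> word_eq [:: (u, true); (v, true)] [:: (v, true); (u, true)].

Definition word_eqb (w1 w2 : {classic word}) : bool := `[< word_eq w1 w2 >].

Lemma word_eqb_refl : reflexive word_eqb.
Proof. by move=> w; apply/asboolP/word_eq_refl. Qed.

Lemma word_eqb_sym : symmetric word_eqb.
Proof. by move=> w1 w2; apply/asboolP/asboolP => /word_eq_sym. Qed.

Lemma word_eqb_trans : transitive word_eqb.
Proof.
move=> w2 w1 w3 /asboolP e12 /asboolP e23.
by apply/asboolP/(word_eq_trans e12 e23).
Qed.

Definition word_equiv : equiv_rel {classic word} :=
  EquivRel word_eqb word_eqb_refl word_eqb_sym word_eqb_trans.

Definition raag : Type := {eq_quot word_equiv}.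
HB.instance Definition _ := Choice.on raag.
HB.instance Definition _ := Quotient.on raag.

Definition class_of (w : word) : raag := \pi_raag (w : {classic word}).

Lemma class_ofP w1 w2 : class_of w1 = class_of w2 <-> word_eq w1 w2.
Proof.
split=> [/eqmodP/asboolP //|e].
by apply/eqmodP/asboolP.
Qed.

Definition word_of (x : raag) : word := repr x.

Lemma word_ofK x : class_of (word_of x) = x.
Proof. exact: reprK. Qed.

Lemma class_ofK w : word_eq (word_of (class_of w)) w.
Proof. by apply/class_ofP; rewrite word_ofK. Qed.

Definition winv (w : word) : word := rev [seq (l.1, ~~ l.2) | l <- w].

Lemma winv_cat w1 w2 : winv (w1 ++ w2) = winv w2 ++ winv w1.
Proof. by rewrite /winv map_cat rev_cat. Qed.

Lemma winvK : involutive winv.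
Proof.
move=> w; rewrite /winv map_rev revK -map_comp.
by rewrite -[RHS]map_id; apply: eq_map => -[v b] /=; rewrite negbK.
Qed.

Lemma winvl w : word_eq (winv w ++ w) [::].
Proof.
elim: w => [|[v b] w IHw]; first exact: word_eq_refl.
rewrite -cat1s winv_cat -catA (catA (winv [:: _])).
apply: word_eq_trans IHw; apply: word_eq_cat; first exact: word_eq_refl.
rewrite -[X in word_eq _ X]cat0s; apply: word_eq_cat (word_eq_refl _).
by have := word_eq_cancel v (~~ b); rewrite negbK.
Qed.

Lemma winvr w : word_eq (w ++ winv w) [::].
Proof. by rewrite -{1}[w]winvK; exact: winvl. Qed.

Lemma winv_eq w1 w2 : word_eq w1 w2 -> word_eq (winv w1) (winv w2).
Proof.
move=> e; apply: (@word_eq_trans _ (winv w1 ++ (w2 ++ winv w2))).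
  rewrite -[X in word_eq X _]cats0; apply: word_eq_cat (word_eq_refl _) _.
  exact: word_eq_sym (winvr _).
rewrite catA -[X in word_eq _ X]cat0s; apply: word_eq_cat (word_eq_refl _).
apply: word_eq_trans (winvl w1).
by apply: word_eq_cat (word_eq_refl _) (word_eq_sym e).
Qed.

Definition raag_mul (x y : raag) : raag := class_of (word_of x ++ word_of y).
Definition raag_one : raag := class_of [::].
Definition raag_inv (x : raag) : raag := class_of (winv (word_of x)).

Lemma class_ofM w1 w2 :
  raag_mul (class_of w1) (class_of w2) = class_of (w1 ++ w2).
Proof. by apply/class_ofP/word_eq_cat; exact: class_ofK. Qed.

Lemma class_ofV w : raag_inv (class_of w) = class_of (winv w).
Proof. by apply/class_ofP/winv_eq/class_ofK. Qed.

Lemma raag_mulA : associative raag_mul.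
Proof.
move=> x y z; rewrite -[x]word_ofK -[y]word_ofK -[z]word_ofK.
by rewrite !class_ofM catA.
Qed.

Lemma raag_mul1 : left_id raag_one raag_mul.
Proof. by move=> x; rewrite -[x]word_ofK class_ofM. Qed.

Lemma raag_mulr1 : right_id raag_one raag_mul.
Proof. by move=> x; rewrite -[x]word_ofK class_ofM cats0. Qed.

Lemma raag_mulV : left_inverse raag_one raag_inv raag_mul.
Proof.
move=> x; rewrite -[x]word_ofK class_ofV class_ofM.
by apply/class_ofP/winvl.
Qed.

Lemma raag_mulrV : right_inverse raag_one raag_inv raag_mul.
Proof.
move=> x; rewrite -[x]word_ofK class_ofV class_ofM.
by apply/class_ofP/winvr.
Qed.

HB.instance Definition _ := isGroup.Build raag
  raag_mulA raag_mul1 raag_mulr1 raag_mulV raag_mulrV.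

Definition raag_gen (v : T) : raag := class_of [:: (v, true)].

(* A(U), for the subgraph induced on U, as a subgroup of A(T). *)
Definition standard_subgroup (U : set T) : set raag :=
  generated (raag_gen @` U).

Definition parabolic (P : set raag) : Prop :=
  exists (g : raag) (U : set T), P = conj_set g (standard_subgroup U).

Definition is_support (x : raag) (P : set raag) : Prop :=
  [/\ parabolic P, P x & forall Q, parabolic Q -> Q x -> P `<=` Q].

Definition ext_vertices : set raag :=
  [set x | exists (g : raag) (v : T), x = g * raag_gen v * g^-1].

Definition ext_adj (x y : set_type ext_vertices) : Prop :=
  x <> y /\ commute (val x) (val y).

Lemma ext_adj_sym x y : ext_adj x y -> ext_adj y x.
Proof. by move=> [nexy cxy]; split; [exact: nesym|exact: esym]. Qed.

Lemma ext_adj_irrefl x : ~ ext_adj x x.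
Proof. by case. Qed.

Definition extension_graph : graph := Graph ext_adj_sym ext_adj_irrefl.

Definition clique_subgroup (K : clique_graph extension_graph) : set raag :=
  generated [set val x | x in clique_set K].

End Raag.

(* Main.v *)
From Stdlib Require Import ZArith Lia.
Require Import Defs.
From HB Require Import structures.
From mathcomp Require Import all_boot generic_quotient.
From mathcomp Require Import boolp classical_sets cardinality.

(** The proof is a game of ping-pong in A(Gamma), played with integer valued
    functions.  For a vertex [a], [height a x] is the exponent of the power of
    [a] that can be brought to the front of a reduced word for [x].
    Multiplying on the left by [a] adds 1 to it, multiplying by a vertex
    adjacent to [a] does not change it, and two distinct non-adjacent vertices
    never have non-zero height at the same point, because they cannot both be
    brought to the front.

    By translation every vertex [v = g a g^-1] of the extension graph gets such
    a function, [ext_height v].  For distinct non-adjacent [u] and [v] the last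
    property becomes coarse: there is a constant C such that at every point one
    of the two heights is at most C in absolute value ([ext_height_far]).  Over
    a finite set of vertices C can be chosen uniformly, and then the sets where
    the height of [v] exceeds C play ping-pong for all powers of the [v] with
    exponents larger than 2C in absolute value; so these powers generate the
    right-angled Artin group of the subgraph that the vertices induce
    ([powers_free]).  An element with support P_K is a product of non-zero
    powers of all the vertices of K ([support_prodw]), so its M-th power, where
    M = 2C + 1, is a product of powers with large exponents.  As C depends only
    on the vertices, M does not depend on the chosen elements.

    It remains to see that the products over the disjoint cliques generate the
    right-angled Artin group of Delta.  The cliques are dismantled one vertex
    at a time ([split_free], [family_free]), and each step is an instance of
    the following fact ([merge_free]).  Let [z1], [z2] be adjacent vertices of
    a graph such that no induced square contains the edge between them, and
    replace them by one vertex [z] whose neighbours are their common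
    neighbours.  Then mapping [z] to the product of [z1] and [z2] and fixing
    the other vertices induces an injective morphism.  The danger is that in
    the image of a reduced word a power of [z1] cancels while the power of [z2]
    next to it does not.  Then some [u] that commutes with [z1] but not with
    [z2] has caught the letter [z2], and the word begins with a power of [z2]
    followed by [u].  A letter [w] that commutes with [z2] but not with [z1]
    could pass [z2] and spoil the game; but [u] and [w] do not commute, since
    [z1], [z2], [w], [u] would otherwise be an induced square.  So [u] blocks
    [w]. *)

Set Implicit Arguments.
Unset Strict Implicit.
Unset Printing Implicit Defensive.

Local Open Scope classical_set_scope.
Local Open Scope group_scope.

#[local] Arguments Z.add : simpl never.
#[local] Arguments Z.mul : simpl never.

(** * Piles: a faithful model of reduced words *)

Definition linv (T : graph) (l : T * bool) : T * bool := (l.1, ~~ l.2).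

Lemma linvK (T : graph) : involutive (@linv T).
Proof. by case=> v b; rewrite /linv /= negbK. Qed.

Section Piles.
Variable T : graph.
Implicit Types (a b u w : T) (S : set T) (l m : T * bool).

(** The pile at [(w, S)] is the projection of a reduced word to the letters
    [w], [w^-1] and to the letters of [S] that do not commute with [w].  The
    former keep their sign; the latter leave only an anonymous mark [None],
    because two of them may commute, and their order is then meaningless. *)
Definition piles : Type := T -> set T -> seq (option bool).
Implicit Type p : piles.

Definition push l p : piles := fun w S =>
  if `[< l.1 = w >] then Some l.2 :: p w S
  else if `[< S l.1 /\ ~ adj l.1 w >] then None :: p w S else p w S.

Definition pop l p : piles := fun w S =>
  if `[< l.1 = w \/ (S l.1 /\ ~ adj l.1 w) >] then behead (p w S) else p w S.

(** Only the pile at [(l.1, setT)] is inspected: it bears a mark for each letter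
    that could hold [l] back. *)
Definition lead l p : Prop := ohead (p l.1 setT) = Some (Some l.2).

Definition act l p : piles :=
  if `[< lead (linv l) p >] then pop (linv l) p else push l p.

(** The piles of reduced words.  They are described by pushes alone, and being
    stable under [act] is a theorem; cancellation and commutation are respected
    by [act] on these piles only. *)
Inductive reachable : piles -> Prop :=
| reachable_nil : reachable (fun _ _ => [::])
| reachable_push l p : reachable p -> ~ lead (linv l) p -> reachable (push l p).

Lemma push_far l p w S :
  l.1 <> w -> adj l.1 w -> push l p w S = p w S.
Proof.
move=> nlw alw; rewrite /push.
by case: asboolP => // _; case: asboolP => // -[].
Qed.

Lemma adj_neq a b : adj a b -> a <> b.
Proof. by move=> aab e; move: aab; rewrite e; exact: adj_irrefl. Qed.

Lemma lead_push_adj l m p : adj l.1 m.1 -> lead l (push m p) <-> lead l p.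
Proof.
move=> alm; rewrite /lead push_far //; first exact/nesym/adj_neq.
exact: adj_sym.
Qed.

Lemma push_lead l p : lead l (push l p).
Proof. by rewrite /lead /push; case: asboolP. Qed.

Lemma pushK l p : pop l (push l p) = p.
Proof.
apply/funext => w; apply/funext => S; rewrite /pop /push.
case: (asboolP (l.1 = w)) => [e|ne]; first by case: asboolP => // -[]; left.
case: (asboolP (S l.1 /\ ~ adj l.1 w)) => h; case: asboolP => //.
  by case; right.
by case.
Qed.

Lemma push_comm l m p : adj l.1 m.1 -> push l (push m p) = push m (push l p).
Proof.
move=> alm; have nlm := adj_neq alm.
apply/funext => w; apply/funext => S; rewrite /push.
case: (asboolP (l.1 = w)) => [e|ne].
  case: (asboolP (m.1 = w)) => [e'|ne']; first by case: nlm; rewrite e e'.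
  case: (asboolP (S m.1 /\ ~ adj m.1 w)) => // -[_ []].
  by rewrite -e; exact: adj_sym.
case: (asboolP (m.1 = w)) => [e'|ne'].
  case: (asboolP (S l.1 /\ ~ adj l.1 w)) => // -[_ []].
  by rewrite -e'.
by case: (asboolP (S l.1 /\ _)); case: (asboolP (S m.1 /\ _)).
Qed.

Lemma lead_push_blocked l m p :
  l.1 <> m.1 -> ~ adj l.1 m.1 -> ~ lead l (push m p).
Proof.
move=> ne na; rewrite /lead /push.
case: asboolP => [/esym//|_]; case: asboolP => [_ //|[]].
by split=> // /adj_sym.
Qed.

(** A leading letter can be pushed last: every letter pushed after it is
    adjacent to it, as it would otherwise have covered it with a mark, and
    adjacent pushes commute. *)
Lemma lead_pushed l p : reachable p -> lead l p ->
  exists p', [/\ p = push l p', reachable p' & ~ lead (linv l) p'].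
Proof.
move=> Rp; elim: Rp l => [l|m p1 R1 IH nm l ll]; first by [].
have [e|ne] := pselect (l.1 = m.1).
  exists p1; have <- : m = l; last by [].
  move: ll; rewrite /lead /push e; case: asboolP => // _ [] e2.
  by case: l m e e2 {nm} => [? ?] [? ?] /= -> ->.
have [alm|nalm] := pselect (adj l.1 m.1); last first.
  by case: (lead_push_blocked ne nalm ll).
have {}ll : lead l p1 by apply/(lead_push_adj _ alm).
have [p2 [e2 R2 nl2]] := IH l ll.
exists (push m p2); split.
- by rewrite e2 push_comm //; exact: adj_sym.
- apply: reachable_push => // h; apply: nm; rewrite e2.
  by apply/lead_push_adj => //=; exact: adj_sym.
- by move/lead_push_adj => /= /(_ alm).
Qed.

Lemma act_pop l p : act l (push (linv l) p) = p.
Proof.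
by rewrite /act; case: asboolP => [_|[]]; [exact: pushK|exact: push_lead].
Qed.

Lemma act_push l p : ~ lead (linv l) p -> act l p = push l p.
Proof. by rewrite /act; case: asboolP. Qed.

Variant act_spec l p : piles -> Prop :=
| ActPush of ~ lead (linv l) p : act_spec l p (push l p)
| ActPop p' of reachable p' & ~ lead l p' & p = push (linv l) p' :
    act_spec l p p'.

Lemma actP l p : reachable p -> act_spec l p (act l p).
Proof.
move=> Rp; have [ll|nl] := pselect (lead (linv l) p).
  have [p' [e R' nl']] := lead_pushed Rp ll.
  rewrite e act_pop; apply: ActPop => //.
  by rewrite linvK in nl'.
by rewrite act_push //; apply: ActPush.
Qed.

Lemma reachable_act l p : reachable p -> reachable (act l p).
Proof. by move=> Rp; case: (actP l Rp) => // h; exact: reachable_push. Qed.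

Lemma actK l p : reachable p -> act l (act (linv l) p) = p.
Proof.
move=> Rp; case: (actP (linv l) Rp) => [_|p' R' nl' e].
  exact: act_pop.
by rewrite linvK in e; rewrite act_push.
Qed.

Lemma act_comm l m p : reachable p -> adj l.1 m.1 ->
  act l (act m p) = act m (act l p).
Proof.
wlog : l m p / lead (linv m) p -> lead (linv l) p.
  move=> H Rp alm.
  have [h|h] := pselect (lead (linv m) p -> lead (linv l) p).
    exact: H.
  apply/esym/H; [move=> _|exact: Rp|exact: adj_sym].
  by apply: contrapT => nm; case: h.
move=> himp Rp alm; have aml := adj_sym alm.
have [ll|nl] := pselect (lead (linv l) p); last first.
  have nm : ~ lead (linv m) p by move/himp.
  rewrite (act_push nl) (act_push nm) act_push; last first.
    by move/(@lead_push_adj (linv l) m p alm).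
  rewrite act_push; last by move/(@lead_push_adj (linv m) l p aml).
  exact: push_comm.
have [p1 [e1 R1 nl1]] := lead_pushed Rp ll.
rewrite e1 act_pop.
have [lm|nm] := pselect (lead (linv m) p).
  have lm1 : lead (linv m) p1.
    by move: lm; rewrite e1 => /(@lead_push_adj (linv m) (linv l) p1 aml).
  have [p2 [e2 R2 nl2]] := lead_pushed R1 lm1.
  by rewrite e2 push_comm // (act_pop m) (act_pop l) (act_pop m).
have nm1 : ~ lead (linv m) p1.
  move=> h; apply: nm; rewrite e1.
  exact: (@lead_push_adj (linv m) (linv l) p1 aml).2 h.
rewrite (act_push nm1) (@act_push m); last by rewrite -e1; exact: nm.
by rewrite push_comm // act_pop.
Qed.

Definition actw (w : word T) p : piles := foldr act p w.

Lemma reachable_actw (w : word T) p : reachable p -> reachable (actw w p).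
Proof. by move=> Rp; elim: w => //= l w; exact: reachable_act. Qed.

Lemma actw_eq (w1 w2 : word T) : word_eq w1 w2 ->
  forall p, reachable p -> actw w1 p = actw w2 p.
Proof.
elim=> {w1 w2} //.
- by move=> w1 w2 _ IH p Rp; rewrite IH.
- by move=> w1 w2 w3 _ IH1 _ IH2 p Rp; rewrite IH1 ?IH2.
- move=> w1 w2 w1' w2' _ IH1 _ IH2 p Rp; rewrite /actw !foldr_cat.
  by have := IH2 p Rp; rewrite /actw => ->; exact/IH1/(reachable_actw w2').
- move=> v b p Rp /=; exact: (@actK (v, b)).
- by move=> u v auv p Rp /=; exact: act_comm.
Qed.

Definition state (x : raag T) : piles := actw (word_of x) (fun _ _ => [::]).

Lemma reachable_state x : reachable (state x).
Proof. exact/reachable_actw/reachable_nil. Qed.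

Definition letter l : raag T := class_of [:: l].

Lemma letter_mul l (w : word T) : letter l * class_of w = class_of (l :: w).
Proof. exact: class_ofM. Qed.

Lemma state_class (w : word T) : state (class_of w) = actw w (fun _ _ => [::]).
Proof. by apply: actw_eq; [exact: class_ofK|exact: reachable_nil]. Qed.

Lemma state_letter l x : state (letter l * x) = act l (state x).
Proof. by rewrite -[x]word_ofK letter_mul !state_class. Qed.

Definition sgb (b : bool) : Z := if b then 1%Z else (-1)%Z.

Fixpoint run (s : seq (option bool)) : Z :=
  if s is Some b :: s' then (sgb b + run s')%Z else 0%Z.

(** In a reduced word all signs of an initial run agree, so the sum is the
    exponent of the power of [a] at the front of [x]. *)
Definition height a (x : raag T) : Z := run (state x a setT).

(** A letter [u] or [u^-1] precedes all the letters [w], [w^-1] of a reduced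
    word, with [u] and [w] not commuting.  In contrast with the condition that
    the height of [u] is not zero, this one survives left multiplication by all
    letters of the other vertices, which do not touch the pile at
    [(w, [set u])]. *)
Definition blocks u w (x : raag T) : Prop :=
  ohead (state x w [set u]) = Some None.

Lemma height1 a : height a 1 = 0%Z.
Proof. by rewrite /height (state_class [::]). Qed.

Lemma height_letter l x : height l.1 (letter l * x) = (sgb l.2 + height l.1 x)%Z.
Proof.
rewrite /height state_letter; case: (actP l (reachable_state x)).
  by move=> _; rewrite {1}/push; case: asboolP.
move=> p' _ _ ->; rewrite {1}/push; case: asboolP => //= _.
by rewrite /linv /=; case: l.2 => /=; lia.
Qed.

Lemma height_adj l a x : adj l.1 a -> height a (letter l * x) = height a x.
Proof.
move=> ala; have na := adj_neq ala; rewrite /height state_letter.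
case: (actP l (reachable_state x)) => [_|p' _ _ ->]; by rewrite push_far.
Qed.

Lemma height_neq0 a x : height a x <> 0%Z ->
  exists (c : bool) p, reachable p /\ state x = push (a, c) p.
Proof.
rewrite /height; case e: (state x a setT) => [//|[b|//] s] _.
have [|p [-> Rp _]] := @lead_pushed (a, b) _ (reachable_state x).
  by rewrite /lead /= e.
by exists b, p.
Qed.

Lemma height_blocks u w x : u <> w -> ~ adj u w -> height u x <> 0%Z ->
  blocks u w x.
Proof.
move=> nuw auw /height_neq0[b [p [_ e]]]; rewrite /blocks e /push /=.
by case: asboolP => // _; case: asboolP => // -[].
Qed.

Lemma blocks_letter u w l x : l.1 <> u -> l.1 <> w ->
  blocks u w x -> blocks u w (letter l * x).
Proof.
move=> lu lw; rewrite /blocks state_letter.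
suff push_id m p : m.1 = l.1 -> push m p w [set u] = p w [set u].
  case: (actP l (reachable_state x)) => [_|p' _ _ ->]; by rewrite push_id.
move=> e; rewrite /push e; case: asboolP => // _.
by case: asboolP => // -[].
Qed.

Lemma blocks_height u w x : blocks u w x -> height w x = 0%Z.
Proof.
move=> bx; apply: contrapT => /height_neq0[b [p [_ e]]].
by move: bx; rewrite /blocks e /push; case: asboolP.
Qed.

End Piles.

(** * Generated subgroups and integer powers *)

Section Generated.
Variable G : groupType.
Implicit Types (A P : set G) (x y : G).

Lemma generated_gen A x : A x -> generated A x.
Proof. by move=> Ax P [_ AP]; exact: AP. Qed.

Lemma generated1 A : generated A 1.
Proof. by move=> P [[P1 _] _]; move: P1; rewrite inE. Qed.

Lemma generatedF A x y : generated A x -> generated A y -> generated A (x / y).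
Proof.
move=> Ax Ay P [sP AP]; have [_ PF] := sP.
have := PF x y; rewrite !inE; apply.
  exact: Ax P (conj sP AP).
exact: Ay P (conj sP AP).
Qed.

Lemma generatedV A x : generated A x -> generated A x^-1.
Proof.
by move=> Ax; rewrite -div1g; apply: generatedF => //; exact: generated1.
Qed.

Lemma generatedM A x y : generated A x -> generated A y -> generated A (x * y).
Proof.
by move=> Ax /generatedV Ay; rewrite -[y]invgK; exact: generatedF Ax Ay.
Qed.

Lemma generated_ind A P : P 1 -> (forall x y, P x -> P y -> P (x * y)) ->
  (forall x, P x -> P x^-1) -> A `<=` P -> generated A `<=` P.
Proof.
move=> P1 PM PV AP x; apply; split=> //; split; first by rewrite inE.
by move=> y z; rewrite !inE => Py Pz; apply: PM => //; exact: PV.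
Qed.

Definition zpow x (k : Z) : G :=
  match k with
  | Z0 => 1 | Zpos n => x ^+ Pos.to_nat n | Zneg n => x ^- Pos.to_nat n
  end.

Lemma zpow_nat x n : zpow x (Z.of_nat n) = x ^+ n.
Proof. by case: n => [//|n] /=; rewrite SuccNat2Pos.id_succ. Qed.

Lemma zpow_opp x k : zpow x (- k) = (zpow x k)^-1.
Proof. by case: k => [|p|p] //=; rewrite ?invg1 ?invgK. Qed.

Lemma zpowS x k : zpow x (1 + k) = x * zpow x k.
Proof.
have [k0|k0] := Z_le_gt_dec 0 k.
  have -> : k = Z.of_nat (Z.to_nat k) by lia.
  have -> : (1 + Z.of_nat (Z.to_nat k))%Z = Z.of_nat (Z.to_nat k).+1 by lia.
  by rewrite !zpow_nat expgS.
have -> : k = (- Z.of_nat (Z.to_nat (- k - 1)).+1)%Z by lia.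
set n := Z.to_nat _.
have -> : (1 + - Z.of_nat n.+1)%Z = (- Z.of_nat n)%Z by lia.
by rewrite !zpow_opp !zpow_nat expgSr invgM mulVKg.
Qed.

Lemma zpowD x j k : zpow x (j + k) = zpow x j * zpow x k.
Proof.
have pos n : zpow x (Z.of_nat n + k) = zpow x (Z.of_nat n) * zpow x k.
  elim: n => [|n IH]; first by rewrite mul1g.
  have -> : (Z.of_nat n.+1 + k)%Z = (1 + (Z.of_nat n + k))%Z by lia.
  rewrite zpowS IH mulgA -zpowS; congr (zpow x _ * _); lia.
have [j0|j0] := Z_le_gt_dec 0 j.
  by have -> : j = Z.of_nat (Z.to_nat j) by lia.
have {2}-> : j = (- (- j))%Z by lia.
have e : (- j)%Z = Z.of_nat (Z.to_nat (- j)) by lia.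
have neg n l : zpow x (- Z.of_nat n + l) = (zpow x (Z.of_nat n))^-1 * zpow x l.
  elim: n l => [|n IH] l; first by rewrite invg1 mul1g.
  have -> : (- Z.of_nat n.+1 + l)%Z = (- Z.of_nat n + (-1 + l))%Z by lia.
  rewrite IH; have {2}-> : l = (1 + (-1 + l))%Z by lia.
  rewrite [zpow x (1 + _)]zpowS zpow_nat (zpow_nat _ n.+1) expgS invgM.
  by rewrite -mulgA mulKg.
rewrite zpow_opp e -neg; congr zpow; lia.
Qed.

Lemma zpow_commute x y k : commute x y -> commute (zpow x k) y.
Proof.
move=> /commute_sym c; apply/commute_sym; case: k => [|p|p] /=.
- exact: commute1.
- exact: commuteX.
- exact/commuteV/commuteX.
Qed.

Lemma zpow_conj g x k : zpow (g * x * g^-1) k = g * zpow x k * g^-1.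
Proof.
have conjX n : (g * x * g^-1) ^+ n = g * x ^+ n * g^-1.
  elim: n => [|n IH]; first by rewrite !expg0 mulg1 mulgV.
  by rewrite !expgS IH !mulgA mulgVK.
case: k => [|p|p] /=; rewrite ?conjX //; first by rewrite mulg1 mulgV.
by rewrite !invgM invgK mulgA.
Qed.

End Generated.

(** * Universal property of A(T) *)

Section Eval.
Variables (T : graph) (G : groupType) (h : T -> G).
Implicit Types (u v : T) (l m : T * bool) (w : word T).

Definition eval_letter l : G := if l.2 then h l.1 else (h l.1)^-1.

Definition eval_word w : G := foldr (fun l x => eval_letter l * x) 1 w.

Lemma eval_word_cat w1 w2 : eval_word (w1 ++ w2) = eval_word w1 * eval_word w2.
Proof. by elim: w1 => [|l w IH] /=; rewrite ?mul1g // IH mulgA. Qed.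

Lemma eval_letter_linv l : eval_letter (linv l) = (eval_letter l)^-1.
Proof. by case: l => v [] //=; rewrite /eval_letter /= invgK. Qed.

Hypothesis h_comm : forall u v, adj u v -> commute (h u) (h v).

Lemma eval_letter_comm l m : adj l.1 m.1 -> commute (eval_letter l) (eval_letter m).
Proof.
move=> /h_comm c; rewrite /eval_letter; case: l.2; case: m.2 => //.
- exact: commuteV.
- exact/commute_sym/commuteV/commute_sym.
- exact/commuteV/commute_sym/commuteV/commute_sym.
Qed.

Lemma eval_word_eq w1 w2 : word_eq w1 w2 -> eval_word w1 = eval_word w2.
Proof.
elim=> {w1 w2} //.
- by move=> w1 w2 w3 _ -> _ ->.
- by move=> w1 w2 w1' w2' _ e1 _ e2; rewrite !eval_word_cat e1 e2.
- move=> v b; rewrite /eval_word /= (eval_letter_linv (v, b)) mulg1; exact: mulgV.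
- by move=> u v /h_comm c; rewrite /eval_word /= !mulg1; exact: c.
Qed.

Definition raag_lift (x : raag T) : G := eval_word (word_of x).

Lemma raag_lift_class w : raag_lift (class_of w) = eval_word w.
Proof. exact/eval_word_eq/class_ofK. Qed.

Lemma raag_liftM : {morph raag_lift : x y / x * y}.
Proof.
move=> x y; rewrite -[x]word_ofK -[y]word_ofK.
by rewrite [_ * _]class_ofM !raag_lift_class eval_word_cat.
Qed.

Lemma raag_lift_gen v : raag_lift (raag_gen v) = h v.
Proof. by rewrite raag_lift_class /eval_word /= mulg1. Qed.

End Eval.

Section LettFacts.
Variable T : graph.

Lemma letterV (l : T * bool) : letter (linv l) = (letter l)^-1.
Proof.
apply/esym/mulg1_eq; rewrite [LHS]class_ofM; apply/class_ofP.
by case: l => v b; exact: word_eq_cancel.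
Qed.

Lemma eval_letter_gen (l : T * bool) : eval_letter (@raag_gen T) l = letter l.
Proof.
by case: l => v [] //; rewrite /eval_letter /= -(letterV (v, true)).
Qed.

Lemma gen_comm (u v : T) : adj u v -> commute (raag_gen u) (raag_gen v).
Proof.
move=> a; rewrite /commute [LHS]class_ofM [RHS]class_ofM.
exact/class_ofP/word_eq_comm.
Qed.

Lemma eval_word_gen (w : word T) : eval_word (@raag_gen T) w = class_of w.
Proof. by elim: w => [//|l w IH] /=; rewrite IH eval_letter_gen letter_mul. Qed.

End LettFacts.

(** * Ping-pong *)

Section PingPong.
Variables (T : graph) (G : groupType) (h : T -> G).
Implicit Types (u v : T) (l m : T * bool) (w : word T).
Hypothesis h_comm : forall u v, adj u v -> commute (h u) (h v).
Variables (Y : T * bool -> G -> Prop) (x0 : G).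

(** Induction on the word, on two letters [l], [m] at its front.  If they do not
    commute, then the point played by the tail lies in [Y m], and [l] sends it
    to [Y l].  If they commute, then [m] is moved in front of [l]: the shorter
    word that starts with [l] lands in [Y l], and [m] preserves this set.  The
    predicate [P] stands for some kind of reducedness, which will be minimality
    of the length among the words for an element, or for a coset. *)
Lemma pingpong (P : word T -> Prop) :
  (forall l w, P (l :: w) -> P w) ->
  (forall l m w, adj l.1 m.1 -> P (l :: m :: w) -> P (m :: l :: w)) ->
  (forall l w, ~ P (l :: linv l :: w)) ->
  (forall l, P [:: l] -> Y l (eval_letter h l * x0)) ->
  (forall l x, Y l x -> Y l (eval_letter h l * x)) ->
  (forall l m x, l.1 <> m.1 -> ~ adj l.1 m.1 -> Y m x ->
     Y l (eval_letter h l * x)) ->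
  (forall l m x, adj m.1 l.1 -> Y l x -> Y l (eval_letter h m * x)) ->
  forall l w, P (l :: w) -> Y l (eval_word h (l :: w) * x0).
Proof.
move=> Ptail Pswap Pred Ybase Yself Yfar Yadj l w; elim: w l => [|m w IH] l Pl.
  by rewrite /= mulg1; exact: Ybase.
have Ym := IH m (Ptail _ _ Pl).
have [e|ne] := pselect (l.1 = m.1).
  have elm : l = m.
    case: l m e {Ym Ptail Ybase Yself Yfar Yadj Pswap} Pl => [v b] [v' b'] /= <-.
    by case: b b' => [] [] Pl //; case: (Pred _ _ Pl).
  by rewrite elm in Pl *; rewrite /= -mulgA; exact: Yself.
have [alm|nlm] := pselect (adj l.1 m.1); last first.
  by rewrite /= -mulgA; apply: Yfar Ym.
have Yl := IH l (Ptail _ _ (Pswap _ _ _ alm Pl)).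
rewrite /= mulgA (eval_letter_comm h_comm alm) -!mulgA.
apply: Yadj; first exact: adj_sym.
by rewrite mulgA.
Qed.

End PingPong.

Section Minimal.
Variable T : graph.
Implicit Types (l m : T * bool) (w : word T) (S : set (raag T)).

(** Shortest words for the left cosets of [S], when [S] is a subgroup. *)
Definition minimal_mod S w : Prop :=
  forall w' s, S s -> class_of w = class_of w' * s -> size w <= size w'.

Lemma minimal_tail S l w : minimal_mod S (l :: w) -> minimal_mod S w.
Proof.
move=> mw w' s Ss e; rewrite -ltnS; apply: (mw (l :: w') s Ss).
by rewrite -!letter_mul -mulgA e.
Qed.

Lemma minimal_swap S l m w : adj l.1 m.1 ->
  minimal_mod S (l :: m :: w) -> minimal_mod S (m :: l :: w).
Proof.
move=> alm mw w' s Ss e; apply: (mw w' s Ss); rewrite -e -!letter_mul !mulgA.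
rewrite -!eval_letter_gen; congr (_ * _).
by apply: eval_letter_comm alm; exact: gen_comm.
Qed.

Lemma minimal_reduced S l w : S 1 -> ~ minimal_mod S (l :: linv l :: w).
Proof.
move=> S1 /(_ w 1 S1); rewrite -!letter_mul letterV mulg1 mulVKg => /(_ erefl).
by rewrite /= ltnNge leqW.
Qed.

Lemma ex_minimal (Q : word T -> Prop) : (exists w, Q w) ->
  exists2 w, Q w & forall w', Q w' -> size w <= size w'.
Proof.
move=> [w Qw]; pose R n := `[< exists2 w, Q w & size w = n >].
have exR : exists n, R n by exists (size w); apply/asboolP; exists w.
case: (ex_minnP exR) => n /asboolP [w' Qw' sw'] nmin.
exists w' => // w2 Qw2; rewrite sw'; apply: nmin; apply/asboolP.
by exists w2.
Qed.

End Minimal.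

(** The map [h] extends to an injective morphism from A(T); the condition is put
    on words, so that no morphism has to be constructed to state it. *)
Definition free_on (T : graph) (G : groupType) (h : T -> G) : Prop :=
  (forall u v, adj u v -> commute (h u) (h v)) /\
  (forall w, eval_word h w = 1 -> word_eq w [::]).

Lemma pingpong_free (T : graph) (G : groupType) (h : T -> G)
    (Y : T * bool -> G -> Prop) (x0 : G) :
  (forall u v, adj u v -> commute (h u) (h v)) ->
  (forall l, Y l (eval_letter h l * x0)) ->
  (forall l, ~ Y l x0) ->
  (forall l x, Y l x -> Y l (eval_letter h l * x)) ->
  (forall l m x, l.1 <> m.1 -> ~ adj l.1 m.1 -> Y m x ->
     Y l (eval_letter h l * x)) ->
  (forall l m x, adj m.1 l.1 -> Y l x -> Y l (eval_letter h m * x)) ->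
  free_on h.
Proof.
move=> hc Ybase Y0 Yself Yfar Yadj; split=> // w ew.
have [|w' eww' wmin] := @ex_minimal T (fun w' => word_eq w w').
  by exists w; exact: word_eq_refl.
case: w' eww' wmin => // l w' eww' wmin.
have /(pingpong hc (Y := Y) (x0 := x0)) : minimal_mod [set 1] (l :: w').
  move=> w2 s -> /esym; rewrite mulg1 => /class_ofP e; apply: wmin.
  exact/(word_eq_trans eww')/word_eq_sym.
have -> : eval_word h (l :: w') * x0 = x0.
  by rewrite -(eval_word_eq hc eww') ew mul1g.
move=> H; case: (Y0 l); apply: H => //.
- by move=> ? ?; exact: minimal_tail.
- by move=> ? ? ?; exact: minimal_swap.
- by move=> ? ?; exact: minimal_reduced.
Qed.

Lemma free_on_inj (T : graph) (G : groupType) (h : T -> G) :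
  free_on h -> injective (raag_lift h).
Proof.
move=> [hc hf] x y exy.
have liftV z : raag_lift h z^-1 = (raag_lift h z)^-1.
  apply/esym/mulg1_eq; rewrite -raag_liftM // mulgV.
  by rewrite (raag_lift_class hc [::]).
apply: divg1_eq; rewrite -[_ / _]word_ofK; apply/class_ofP/hf.
by rewrite -/(raag_lift h _) raag_liftM // liftV exy mulgV.
Qed.

(** * Heights and conjugates of vertices *)

Section DoubleCosets.
Variable T : graph.
Implicit Types (a b u v : T) (x y r s t : raag T) (w : word T).

Definition link a : set T := [set v | adj a v].
Definition star a : set T := [set v | v = a \/ adj a v].

Lemma shift_zpow (G : groupType) (f : G -> Z) (g : G) :
  (forall z, f (g * z) = (1 + f z)%Z) ->
  forall k z, f (zpow g k * z) = (k + f z)%Z.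
Proof.
move=> fS.
have pos n z : f (g ^+ n * z) = (Z.of_nat n + f z)%Z.
  elim: n => [|n IH]; first by rewrite expg0 mul1g; lia.
  by rewrite expgS -mulgA fS IH; lia.
move=> k z; have [k0|k0] := Z_le_gt_dec 0 k.
  have -> : k = Z.of_nat (Z.to_nat k) by lia.
  by rewrite zpow_nat pos.
have e : k = (- Z.of_nat (Z.to_nat (- k)))%Z by lia.
have ek : zpow g k = (g ^+ Z.to_nat (- k))^-1.
  by rewrite {1}e zpow_opp zpow_nat.
have := pos (Z.to_nat (- k)) (zpow g k * z); rewrite {1}ek mulVKg; lia.
Qed.

Lemma height_zpow a k x :
  height a (zpow (raag_gen a) k * x) = (k + height a x)%Z.
Proof. by apply: shift_zpow => {}x; exact: (height_letter (a, true)). Qed.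

Lemma standard_gen (U : set T) v : U v -> standard_subgroup U (raag_gen v).
Proof. by move=> Uv; apply: generated_gen; exists v. Qed.

Lemma height_link a s x :
  standard_subgroup (link a) s -> height a (s * x) = height a x.
Proof.
move=> Ls; move: s Ls x; apply: generated_ind.
- by move=> x; rewrite mul1g.
- by move=> s t IHs IHt x; rewrite -mulgA IHs IHt.
- by move=> s IHs x; rewrite -[in RHS](mulVKg s x) IHs.
- move=> _ [v av <-] x; apply: (height_adj (l := (v, true))); exact: adj_sym.
Qed.

Lemma link_commute a s :
  standard_subgroup (link a) s -> commute (raag_gen a) s.
Proof.
move: s; apply: generated_ind.
- exact: commute1.
- by move=> s t; exact: commuteM.
- by move=> s; exact: commuteV.
- by move=> _ [v av <-]; exact: gen_comm.
Qed.

Lemma star_decomp a s : standard_subgroup (star a) s ->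
  exists k s', standard_subgroup (link a) s' /\ s = zpow (raag_gen a) k * s'.
Proof.
move: s; apply: generated_ind.
- exists 0%Z, 1; split; [exact: generated1|by rewrite mulg1].
- move=> _ _ [k [s [Ls ->]]] [j [t [Lt ->]]]; exists (k + j)%Z, (s * t).
  split; first exact: generatedM.
  rewrite zpowD -!mulgA; congr (_ * _); rewrite !mulgA; congr (_ * _).
  exact/esym/zpow_commute/link_commute.
- move=> _ [k [s [Ls ->]]]; exists (- k)%Z, s^-1.
  have Ls' := generatedV Ls; split=> //.
  by rewrite invgM zpow_opp -zpow_opp; exact/esym/zpow_commute/link_commute.
- move=> _ [v [->|av] <-].
    exists 1%Z, 1; split; first exact: generated1.
    by rewrite mulg1 /= expg1.
  by exists 0%Z, (raag_gen v); split; [exact: standard_gen|rewrite mul1g].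
Qed.

Lemma star_commute a s :
  standard_subgroup (star a) s -> commute (raag_gen a) s.
Proof.
move=> /star_decomp[k [s' [Ls ->]]]; apply: commuteM; last exact: link_commute.
exact/commute_sym/zpow_commute/commute_refl.
Qed.

Lemma star_letter a (l : T * bool) :
  star a l.1 -> standard_subgroup (star a) (letter l).
Proof.
move=> sl; have := standard_gen sl; case: l {sl} => v [] //= /generatedV.
by rewrite (letterV (v, true)).
Qed.

Lemma height_far u v x :
  u <> v -> ~ adj u v -> height u x <> 0%Z -> height v x = 0%Z.
Proof.
by move=> nuv auv hu; apply: (@blocks_height _ u); exact: height_blocks.
Qed.

(** Take [w] of minimal length.  It is then also shortest in its coset modulo
    A(star b), so ping-pong can be started from a point where [b] has non-zero
    height: the letters that [b] lets through have been absorbed by [t].  It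
    shows that the first letter of [w] has non-zero height at [w x]; by
    minimality again this letter is not in the star of [a], which forces the
    height of [a] to vanish there. *)
Lemma double_coset a b r : exists s w t,
  [/\ standard_subgroup (star a) s, standard_subgroup (star b) t,
      r = s * class_of w * t &
      w = [::] \/
      forall x, height b x <> 0%Z -> height a (class_of w * x) = 0%Z].
Proof.
pose Q w := exists s t, [/\ standard_subgroup (star a) s,
  standard_subgroup (star b) t & r = s * class_of w * t].
have [|w [s [t [As Bt er]]] wmin] := @ex_minimal T Q.
  exists (word_of r), 1, 1; split; try exact: generated1.
  by rewrite mul1g mulg1 word_ofK.
exists s, w, t; split=> //; case: w er wmin => [|l w] er wmin; first by left.
right=> x hx.
have mw : minimal_mod (standard_subgroup (star b)) (l :: w).
  move=> w' t' Bt' e; apply: wmin; exists s, (t' * t); split=> //.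
    exact: generatedM.
  by rewrite er e !mulgA.
have nla : ~ star a l.1.
  move=> sl; have /wmin : Q w; last by rewrite ltnn.
  exists (s * letter l), t; split=> //.
    by apply: generatedM => //; exact: star_letter.
  by rewrite er -letter_mul !mulgA.
pose Y (m : T * bool) (y : raag T) := (0 < sgb m.2 * height m.1 y)%Z.
have : Y l (eval_word (@raag_gen T) (l :: w) * x).
  apply: (pingpong (@gen_comm T) _ _ _ _ _ _ _ mw).
  - by move=> ? ?; exact: minimal_tail.
  - by move=> ? ? ?; exact: minimal_swap.
  - by move=> ? ?; apply: minimal_reduced; exact: generated1.
  - move=> m mm; rewrite eval_letter_gen /Y height_letter.
    have nmb : ~ star b m.1.
      move=> sm; have /(_ [::] (letter m)) := mm; rewrite mul1g => H.
      by have := H (star_letter sm) erefl.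
    rewrite (height_far _ _ hx); first by case: m.2 => /=; lia.
    + by move=> e; apply: nmb; left.
    + by move=> bm; apply: nmb; right.
  - by move=> m y; rewrite eval_letter_gen /Y height_letter; case: m.2 => /=; lia.
  - move=> m n y nmn amn hn; rewrite eval_letter_gen /Y height_letter.
    rewrite (@height_far n.1 m.1); first by case: m.2 => /=; lia.
    + exact: nesym.
    + by move/adj_sym.
    + by move: hn; rewrite /Y; lia.
  - by move=> m n y anm; rewrite eval_letter_gen /Y height_adj.
rewrite eval_word_gen /Y => hl; apply: (@height_far l.1 a).
- by move=> e; apply: nla; left.
- by move=> e; apply: nla; right; exact: adj_sym.
- by move=> h0; move: hl; rewrite h0; lia.
Qed.

(** If [x] and [y] commuted, then for [k] other than 0 the value of [f] at
    [x^k y = y x^k] would be [k + f y], but also 0 because [f'] is 1 there. *)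
Lemma not_commute_disjoint (G : groupType) (x y : G) (f f' : G -> Z) :
  (forall k z, f (zpow x k * z) = (k + f z)%Z) ->
  (forall k z, f' (zpow y k * z) = (k + f' z)%Z) ->
  f 1 = 0%Z -> (forall z, f z <> 0%Z -> f' z = 0%Z) -> ~ commute x y.
Proof.
move=> fx fy f1 ff c.
have H k : (k <> 0)%Z -> (k + f y = 0)%Z.
  move=> k0; rewrite -fx; apply: contrapT => /ff.
  rewrite (zpow_commute k c) -{1}(expg1 y) -[y ^+ 1]/(zpow y 1) fy.
  rewrite -[zpow x k]mulg1 ff; first lia.
  by rewrite fx f1; lia.
by have := H 1%Z; have := H 2%Z; lia.
Qed.

(** The first case holds when the middle factor of the double coset
    decomposition is non-trivial, or when it is trivial and [a], [b] are
    distinct and not adjacent; the outer factors only shift the heights by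
    constants, and these give the bound. *)
Lemma conj_dichotomy a b r :
  (~ commute (raag_gen a) (r * raag_gen b * r^-1) /\
   exists C, forall x, (Z.abs (height a x) <= C \/
                        Z.abs (height b (r^-1 * x)%g) <= C)%Z) \/
  ((a = b \/ adj a b) /\ exists s t,
     [/\ standard_subgroup (star a) s, standard_subgroup (star b) t & r = s * t]).
Proof.
have [s [w [t [As Bt er hw]]]] := double_coset a b r.
have [[w0 ab]|nab] := pselect (w = [::] /\ (a = b \/ adj a b)).
  right; split=> //; exists s, t; split=> //.
  by rewrite er w0 mulg1.
left; have {nab} {hw} hw x : height b x <> 0%Z -> height a (class_of w * x) = 0%Z.
  case: hw => [e|]; last by apply.
  rewrite e mul1g; apply: height_far.
    by move=> eba; apply: nab; split=> //; left.
  by move=> aba; apply: nab; split=> //; right; exact: adj_sym.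
pose W := class_of w; rewrite -/W in er hw.
split.
  move=> c; pose f' z := height b (W^-1 * z).
  have : ~ commute (raag_gen a) (W * raag_gen b * W^-1).
    apply: (@not_commute_disjoint _ _ _ (height a) f').
    - by move=> k z; exact: height_zpow.
    - by move=> k z; rewrite /f' zpow_conj -!mulgA mulKg height_zpow.
    - exact: height1.
    - move=> z hz; apply: contrapT => /hw; by rewrite mulVKg.
  apply; have ct := star_commute Bt; have cs := star_commute As.
  have e : r * raag_gen b * r^-1 = s * (W * raag_gen b * W^-1) * s^-1.
    rewrite er !invgM -!mulgA; do 2 congr (_ * _).
    by rewrite !mulgA -ct mulgK.
  move: c; rewrite e => c.
  have : commute (raag_gen a) (s^-1 * (s * (W * raag_gen b * W^-1) * s^-1) * s).
    by apply: commuteM => //; apply: commuteM => //; exact: commuteV.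
  by rewrite !mulgA mulVg mul1g mulgVK.
have [k [s' [Ls es]]] := star_decomp As.
have [j [t' [Lt et]]] := star_decomp Bt.
exists (Z.abs k + Z.abs j)%Z => x; pose y := s^-1 * x.
have hx : height a x = (k + height a y)%Z.
  by rewrite -[x](mulVKg s) {1}es -mulgA height_zpow height_link.
have hy : height b (W^-1 * y) = (j + height b (r^-1 * x)%g)%Z.
  have -> : W^-1 * y = t * (r^-1 * x).
    by rewrite /y er !invgM !mulgA mulgV mul1g.
  by rewrite {1}et -mulgA height_zpow height_link.
have [h0|h0] := pselect (height b (W^-1 * y) = 0%Z); first by right; lia.
by left; have := hw _ h0; rewrite mulVKg; lia.
Qed.

End DoubleCosets.

Section Ext.
Variable Gamma : graph.
Notation E := (extension_graph Gamma).
Implicit Types (u v : E) (x : raag Gamma).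

Lemma ext_rep v : exists ga : raag Gamma * Gamma,
  val v = ga.1 * raag_gen ga.2 * ga.1^-1.
Proof. by have := valP v; rewrite inE => -[g [a ->]]; exists (g, a). Qed.

Definition rep v := projT1 (cid (ext_rep v)).

Lemma repE v : val v = (rep v).1 * raag_gen (rep v).2 * (rep v).1^-1.
Proof. exact: projT2 (cid (ext_rep v)). Qed.

(** The function that the conjugator of [v] transports from [height]. *)
Definition ext_height v x : Z := height (rep v).2 ((rep v).1^-1 * x).

Lemma ext_height_zpow v k x :
  ext_height v (zpow (val v) k * x) = (k + ext_height v x)%Z.
Proof. by rewrite /ext_height {1}repE zpow_conj -!mulgA mulKg height_zpow. Qed.

Lemma commute_conj (G : groupType) (g x y : G) :
  commute x (g * y * g^-1) <-> commute (g^-1 * x * g) y.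
Proof.
split=> [c|c].
  have : g^-1 * (x * (g * y * g^-1)) * g = g^-1 * (g * y * g^-1 * x) * g.
    by rewrite c.
  by rewrite !mulgA mulgVK mulVg mul1g => e; rewrite /commute !mulgA e.
have : g * (g^-1 * x * g * y) * g^-1 = g * (y * (g^-1 * x * g)) * g^-1.
  by rewrite c.
by rewrite !mulgA mulgV mul1g mulgK => e; rewrite /commute !mulgA e.
Qed.

Lemma val_conj u v : (rep v).1^-1 * val u * (rep v).1 =
  ((rep v).1^-1 * (rep u).1) * raag_gen (rep u).2 * ((rep v).1^-1 * (rep u).1)^-1.
Proof. by rewrite {1}repE invgM invgK !mulgA. Qed.

Lemma commute_val u v : commute (val v) (val u) <->
  commute (raag_gen (rep v).2) ((rep v).1^-1 * val u * (rep v).1).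
Proof.
rewrite [val v]repE; split.
  move=> c; apply/commute_sym/(commute_conj _ _ _).1.
  exact/commute_sym.
by move=> c; apply/commute_sym/(commute_conj _ _ _).2/commute_sym.
Qed.

(** The part of the centralizer theorem that matters here: up to conjugation [v]
    is a vertex [a], and any other conjugate of a vertex that commutes with [a]
    lies in A(link a), hence does not change the height of [a]. *)
Lemma adj_link u v : adj u v -> exists2 s,
  standard_subgroup (link (rep v).2) s & val u = (rep v).1 * s * (rep v).1^-1.
Proof.
move=> [nuv /commute_sym /commute_val]; have e := val_conj u v.
set r := _ * (rep u).1 in e; set a := (rep v).2; set b := (rep u).2 in e.
move=> c; have [[nc _]|[ab [s [t [As Bt er]]]]] := conj_dichotomy a b r.
  by case: nc; rewrite -e.
have cs := star_commute As; have ct := star_commute Bt.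
have e1 : (rep v).1^-1 * val u * (rep v).1 = s * raag_gen b * s^-1.
  by rewrite e er invgM !mulgA -(mulgA s) -ct mulgA mulgK.
have e2 : val u = (rep v).1 * (s * raag_gen b * s^-1) * (rep v).1^-1.
  by rewrite -e1 !mulgA mulgV mul1g mulgK.
case: ab => [eab|ab].
  case: nuv; apply: val_inj; rewrite e2 [RHS]repE -/a -eab.
  by rewrite -cs mulgK.
have [k [s' [Ls es]]] := star_decomp As.
have Ls'' : standard_subgroup (link a) (s' * raag_gen b * s'^-1).
  by apply: generatedM; [apply: generatedM|apply: generatedV] => //;
    exact: standard_gen.
exists (s' * raag_gen b * s'^-1) => //.
rewrite e2; congr (_ * _ * _); rewrite es invgM !mulgA.
have /(zpow_commute k) := link_commute Ls''; rewrite /commute !mulgA => ->.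
by rewrite mulgK.
Qed.

Lemma ext_height_adj u v k x :
  adj u v -> ext_height v (zpow (val u) k * x) = ext_height v x.
Proof.
move=> /adj_link[s Ls e].
have step y : ext_height v (val u * y) = ext_height v y.
  by rewrite /ext_height e -!mulgA mulKg height_link.
have stepN y : ext_height v ((val u)^-1 * y) = ext_height v y.
  by rewrite -[in RHS](mulVKg (val u) y) step.
case: k => [|p|p] /=; first by rewrite mul1g.
  elim: (Pos.to_nat p) => [|n IH]; first by rewrite mul1g.
  by rewrite expgS -mulgA step.
rewrite -expVgn; elim: (Pos.to_nat p) => [|n IH]; first by rewrite mul1g.
by rewrite expgS -mulgA stepN.
Qed.

(** The analogue for right-angled Artin groups of Behrstock's inequality for
    subsurface projections. *)
Lemma ext_height_far u v : u <> v -> ~ adj u v ->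
  exists C, forall x,
    (Z.abs (ext_height v x) <= C \/ Z.abs (ext_height u x) <= C)%Z.
Proof.
move=> nuv nadj; have nc : ~ commute (val v) (val u).
  by move=> c; apply: nadj; split=> //; exact/commute_sym.
have e := val_conj u v.
set r := _ * (rep u).1 in e; set a := (rep v).2; set b := (rep u).2 in e.
have [[_ [C HC]]|[ab [s [t [As Bt er]]]]] := conj_dichotomy a b r.
  exists C => x; have := HC ((rep v).1^-1 * x).
  by rewrite /ext_height /r invgM invgK -mulgA mulVKg.
case: nc; apply/commute_val; rewrite e er.
have cs := star_commute As; have ct := star_commute Bt.
have -> : s * t * raag_gen b * (s * t)^-1 = s * raag_gen b * s^-1.
  by rewrite invgM !mulgA -(mulgA s) -ct mulgA mulgK.
have cab : commute (raag_gen a) (raag_gen b).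
  by case: ab => [<-|ab]; [exact: commute_refl|exact: gen_comm].
apply: commuteM; last exact: commuteV.
exact: commuteM.
Qed.

End Ext.

Lemma sgb_cases b : (sgb b = 1 \/ sgb b = -1)%Z.
Proof. by case: b; [left|right]. Qed.

(** * Large powers of vertices of the extension graph *)

Section Powers.
Variable Gamma : graph.
Notation E := (extension_graph Gamma).

(** Ping-pong with the half-spaces where the height of [e i], with the sign of
    the exponent of the letter in question, exceeds [C].  An exponent larger
    than [2 C] in absolute value moves every point with height between [- C]
    and [C] into one of them. *)
Lemma powers_free (T : graph) (e : T -> E) (k : T -> Z) (C : Z) :
  injective e -> (forall i j, adj i j <-> adj (e i) (e j)) ->
  (forall i, Z.abs (ext_height (e i) 1%g) <= C)%Z ->
  (forall i j, e i <> e j -> ~ adj (e i) (e j) -> forall x,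
     Z.abs (ext_height (e i) x) <= C \/ Z.abs (ext_height (e j) x) <= C)%Z ->
  (forall i, 2 * C < Z.abs (k i))%Z ->
  free_on (fun i => zpow (val (e i)) (k i)).
Proof.
move=> e_inj eadj C1 Cfar kC; set h := (fun i => _).
pose o (l : T * bool) := (sgb l.2 * Z.sgn (k l.1))%Z.
have ocase l : ((o l = 1 /\ sgb l.2 * k l.1 = Z.abs (k l.1)) \/
                (o l = -1 /\ sgb l.2 * k l.1 = - Z.abs (k l.1)))%Z.
  have := C1 l.1; have := kC l.1; rewrite /o.
  by case: (sgb_cases l.2) => ->;
    case: (Z.sgn_spec (k l.1)) => [[? ->]|[[? ->]|[? ->]]]; lia.
have hl l x : ext_height (e l.1) (eval_letter h l * x) =
    (sgb l.2 * k l.1 + ext_height (e l.1) x)%Z.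
  case: l => i b; rewrite -ext_height_zpow; congr (ext_height _ (_ * _)).
  by case: b; rewrite /eval_letter /h /= -?zpow_opp; congr zpow; lia.
have hadj l m x : adj m.1 l.1 ->
    ext_height (e l.1) (eval_letter h m * x) = ext_height (e l.1) x.
  case: m => i b /= /eadj ail.
  by case: b; rewrite /eval_letter /h /= -?zpow_opp ext_height_adj.
pose Y l x := (C < o l * ext_height (e l.1) x)%Z.
pose x0 : raag Gamma := 1.
have {}C1 i : (Z.abs (ext_height (e i) x0) <= C)%Z := C1 i.
apply: (@pingpong_free _ _ h Y x0).
- move=> i j /eadj[_ c]; rewrite /h.
  exact/zpow_commute/commute_sym/zpow_commute/commute_sym.
- move=> l; rewrite /Y hl; have := C1 l.1; have := kC l.1.
  by case: (ocase l) => -[-> ->]; lia.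
- by move=> l; rewrite /Y; have := C1 l.1; case: (ocase l) => -[-> _]; lia.
- move=> l x; rewrite /Y hl; have := C1 l.1; have := kC l.1.
  by case: (ocase l) => -[-> ->]; lia.
- move=> l m x nlm alm; rewrite /Y hl; have := kC l.1.
  have := Cfar l.1 m.1 (fun eq_e => nlm (e_inj _ _ eq_e))
    (fun adj_e => alm ((eadj _ _).2 adj_e)) x.
  by case: (ocase m) => -[-> _]; case: (ocase l) => -[-> ->]; lia.
- by move=> l m x alm; rewrite /Y hadj.
Qed.

End Powers.

(** * Merging the end points of an edge that lies in no induced square *)

Section Merge.
Variable T : graph.
Implicit Types (z u w : T) (b : bool) (x : raag T).

(** What can be said of the image of a reduced word that starts with the merged
    vertex, when only the power of [z'] is known to survive at its front: some
    [u] that commutes with [z] but not with [z'] follows, and blocks all the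
    letters that could overtake [z'] although they do not commute with [z]. *)
Definition one_sided z z' b x : Prop :=
  (0 < sgb b * height z' x)%Z /\
  exists u, [/\ adj z u, ~ adj z' u, u <> z' &
    forall w, adj z' w -> ~ adj z w -> w <> z -> blocks u w x].

Lemma one_sided_letter z z' b (l : T * bool) x : z' <> l.1 \/ l.2 = b ->
  l.1 = z \/ l.1 = z' \/ (adj l.1 z /\ adj l.1 z') -> adj z z' ->
  one_sided z z' b x -> one_sided z z' b (letter l * x).
Proof.
move=> lb lzz' azz' [hz' [u [azu az'u uz' bu]]]; split.
  case: (pselect (l.1 = z')) => [e|ne].
    case: lb => [nz'|lb]; first by case: nz'.
    move: hz'; rewrite -e height_letter lb.
    by case: (sgb_cases b) => ->; lia.
  rewrite height_adj //; case: lzz' => [->//|[//|[]//]].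
exists u; split=> // w az'w azw wz; apply: blocks_letter; last exact: bu.
- move=> e; case: lzz' => [e'|[e'|[_ a]]].
  + by apply: (@adj_irrefl _ z); rewrite -{2}e' e.
  + by apply: uz'; rewrite -e.
  + by apply: az'u; rewrite -e; exact: adj_sym.
- move=> e; case: lzz' => [e'|[e'|[a _]]].
  + by apply: wz; rewrite -e.
  + by apply: (@adj_irrefl _ z'); rewrite -{2}e' e.
  + by apply: azw; rewrite -e; exact: adj_sym.
Qed.

Lemma one_sided_height z z' b x w : adj z z' -> w <> z -> w <> z' ->
  ~ (adj z w /\ adj z' w) -> one_sided z z' b x -> height w x = 0%Z.
Proof.
move=> azz' wz wz' naw [hz' [u [_ _ _ bu]]].
have [az'w|naz'w] := pselect (adj z' w); last first.
  apply: (@height_far _ z') => //; first exact: nesym.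
  by move=> h; move: hz'; rewrite h; lia.
by apply/blocks_height/bu => // azw; apply: naw.
Qed.

(** This is where the square [z], [z'], [q], [p] is excluded: it makes [u] block
    [w], and a blocked letter stays blocked when [z] and [z'] are added. *)
Lemma one_sided_push z z' b u x : adj z z' ->
  (forall p q, adj z p -> ~ adj z' p -> p <> z' ->
     adj z' q -> ~ adj z q -> q <> z -> ~ adj p q) ->
  adj z u -> ~ adj z' u -> u <> z' -> height u x <> 0%Z ->
  one_sided z z' b (letter (z, b) * (letter (z', b) * x)).
Proof.
move=> azz' nosq azu az'u uz' hu; split.
  rewrite height_adj // (height_letter (z', b)) /= (@height_far _ u z' x) //.
    by case: b => /=; lia.
  by move/adj_sym.
exists u; split=> // w az'w azw wz.
have uz : u <> z by exact/nesym/adj_neq.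
have z'w := adj_neq az'w.
apply: blocks_letter => /=; [exact: nesym|exact: nesym|].
apply: blocks_letter => /=; [exact: nesym|by []|].
apply: height_blocks => //; last exact: (nosq).
by move=> e; apply: azw; rewrite -e.
Qed.

End Merge.

Section MergeFree.
Variables (T T' : graph) (z1 z2 : T') (z : T) (e : T -> T').
Hypothesis z12 : adj z1 z2.
Hypothesis e_new : forall i, i <> z -> e i <> z1 /\ e i <> z2.
Hypothesis e_inj : forall i j, i <> z -> j <> z -> e i = e j -> i = j.
Hypothesis e_adj : forall i j, i <> z -> j <> z -> (adj i j <-> adj (e i) (e j)).
Hypothesis z_adj : forall i, i <> z ->
  (adj z i <-> adj z1 (e i) /\ adj z2 (e i)).
Hypothesis nosq : forall p q, adj z1 p -> ~ adj z2 p -> p <> z2 ->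
  adj z2 q -> ~ adj z1 q -> q <> z1 -> ~ adj p q.

Definition merge (i : T) : raag T' :=
  if `[< i = z >] then raag_gen z1 * raag_gen z2 else raag_gen (e i).

(** Ping-pong, where the region of the merged vertex consists of the points at
    which both halves survive and of those at which exactly one is known to
    survive and is followed by a blocking letter.  In each case no letter that
    is not adjacent to the merged vertex can be brought to the front. *)
Lemma merge_free : free_on merge.
Proof.
have z21 := adj_sym z12; have n12 := adj_neq z12; have n21 := nesym n12.
have nosq' p q : adj z2 p -> ~ adj z1 p -> p <> z1 ->
    adj z1 q -> ~ adj z2 q -> q <> z2 -> ~ adj p q.
  by move=> ? ? ? ? ? ? /adj_sym; exact: nosq.
have mz (b : bool) x :
    eval_letter merge (z, b) * x = letter (z1, b) * (letter (z2, b) * x).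
  rewrite mulgA; congr (_ * _).
  rewrite /eval_letter /merge /=; case: asboolP => // _.
  have c := gen_comm z12; case: b => //=.
  by rewrite c invgM -!(letterV (_, true)).
have mz' (b : bool) x :
    eval_letter merge (z, b) * x = letter (z2, b) * (letter (z1, b) * x).
  rewrite mz !mulgA; congr (_ * _); rewrite -!eval_letter_gen.
  by apply: eval_letter_comm; [exact: gen_comm|].
have me i (b : bool) x : i <> z ->
    eval_letter merge (i, b) * x = letter (e i, b) * x.
  move=> iz; congr (_ * _).
  rewrite /eval_letter /merge /=; case: asboolP => // _.
  exact: (eval_letter_gen (e i, b)).
pose Yz b x := [\/ (0 < sgb b * height z1 x /\ 0 < sgb b * height z2 x)%Z,
                  one_sided z1 z2 b x | one_sided z2 z1 b x].
pose Y (l : T * bool) x :=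
  if `[< l.1 = z >] then Yz l.2 x else (0 < sgb l.2 * height (e l.1) x)%Z.
have Yzz b x : Y (z, b) x = Yz b x by rewrite /Y; case: asboolP.
have Ye i b x : i <> z -> Y (i, b) x = (0 < sgb b * height (e i) x)%Z.
  by rewrite /Y; case: asboolP.
have h1 (b : bool) x :
    height z1 (eval_letter merge (z, b) * x) = (sgb b + height z1 x)%Z.
  by rewrite mz (height_letter (z1, b)) height_adj.
have h2 (b : bool) x :
    height z2 (eval_letter merge (z, b) * x) = (sgb b + height z2 x)%Z.
  by rewrite mz' (height_letter (z2, b)) height_adj.
have naz i : i <> z -> ~ adj z i -> ~ (adj z1 (e i) /\ adj z2 (e i)).
  by move=> iz nai /(z_adj iz).
apply: (@pingpong_free _ _ merge Y 1).
- move=> u v; rewrite /merge.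
  case: asboolP => [->|nu]; case: asboolP => [->|nv].
  + by move/adj_irrefl.
  + case/(z_adj nv) => a1 a2; apply/commute_sym/commuteM;
      exact/commute_sym/gen_comm.
  + move/adj_sym; case/(z_adj nu) => a1 a2; apply/commuteM;
      exact/commute_sym/gen_comm.
  + by move/(e_adj nu nv)/gen_comm.
- move=> [i b]; have [->|iz] := pselect (i = z).
    rewrite Yzz; apply: Or31; rewrite h1 h2 !height1; by case: b => /=; lia.
  by rewrite Ye // me // (height_letter (e i, b)) height1; case: b => /=; lia.
- move=> [i b]; have [->|iz] := pselect (i = z); last first.
    by rewrite Ye // height1; lia.
  by rewrite Yzz => -[[]|[]|[]]; rewrite !height1; lia.
- move=> [i b] x; have [->|iz] := pselect (i = z); last first.
    by rewrite !Ye // me // (height_letter (e i, b)); case: b => /=; lia.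
  rewrite !Yzz => -[H|H|H].
  + by apply: Or31; rewrite h1 h2; case: b H => /=; lia.
  + apply: Or32; rewrite mz; apply: one_sided_letter => //=; [by right|by left|].
    by apply: one_sided_letter => //=; [by right|by right; left].
  + apply: Or33; rewrite mz'; apply: one_sided_letter => //=; [by right|by left|].
    by apply: one_sided_letter => //=; [by right|by right; left].
- move=> [i b] [j c] x /=.
  have [->|iz] := pselect (i = z); have [->|jz] := pselect (j = z) => // ij aij.
  + rewrite Yzz Ye // => hj; have {}hj : height (e j) x <> 0%Z.
      by move=> h0; move: hj; rewrite h0; lia.
    (* If [e j] commutes with neither half, then both survive; otherwise it is
       the blocking letter. *)
    have [ej1 ej2] := e_new jz; have := naz j jz aij.
    have [a1|na1] := pselect (adj z1 (e j)).
      move=> na; apply: Or32; rewrite mz; apply: one_sided_push hj => //.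
      by move=> a2; apply: na.
    have [a2|na2] := pselect (adj z2 (e j)) => _.
      by apply: Or33; rewrite mz'; apply: one_sided_push hj.
    apply: Or31; rewrite h1 h2 (@height_far _ (e j) z1 x) //.
      rewrite (@height_far _ (e j) z2 x) //.
    * by case: b => /=; lia.
    * by move/adj_sym.
    * by move/adj_sym.
  + rewrite Yzz Ye // me // (height_letter (e i, b)) /= => H.
    have [ei1 ei2] := e_new iz.
    have na := naz i iz (fun a => aij (adj_sym a)).
    suff -> : height (e i) x = 0%Z by case: b => /=; lia.
    case: H => [[H1 H2]|H|H]; last 2 first.
    * exact: one_sided_height H.
    * by apply: one_sided_height H => // -[? ?]; apply: na.
    have [a1|na1] := pselect (adj z1 (e i)).
      apply: (@height_far _ z2); [exact: nesym| |].
        by move=> a2; apply: na.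
      by move=> h0; move: H2; rewrite h0; lia.
    apply: (@height_far _ z1) => //; first exact: nesym.
    by move=> h0; move: H1; rewrite h0; lia.
  + rewrite !Ye // me // (height_letter (e i, b)) /= => H.
    rewrite (@height_far _ (e j)); first by case: b => /=; lia.
    * by move=> eji; apply: ij; exact/e_inj.
    * by move/adj_sym/(e_adj iz jz).
    * by move=> h0; move: H; rewrite h0; lia.
- move=> [i b] [j c] x /=.
  have [->|iz] := pselect (i = z); have [->|jz] := pselect (j = z).
  + by move/adj_irrefl.
  + move/adj_sym/(z_adj jz) => [a1 a2]; rewrite !Yzz me //.
    have [a1' a2'] := (adj_sym a1, adj_sym a2); have [ej1 ej2] := e_new jz.
    case=> H; [apply: Or31|apply: Or32|apply: Or33].
    * by rewrite !height_adj.
    * by apply: one_sided_letter H => //=; [left; exact: nesym|by right; right].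
    * by apply: one_sided_letter H => //=; [left; exact: nesym|by right; right].
  + by move/(z_adj iz) => [a1 a2]; rewrite !Ye // mz !height_adj.
  + by move/(e_adj jz iz) => a; rewrite !Ye // me // height_adj.
Qed.

Lemma free_on_merge (G : groupType) (h' : T' -> G) (h : T -> G) :
  free_on h' -> h z = h' z1 * h' z2 -> (forall i, i <> z -> h i = h' (e i)) ->
  free_on h.
Proof.
move=> free' hz he; have [c' _] := free'; have [cm fm] := merge_free.
have em i : h i = raag_lift h' (merge i).
  rewrite /merge; case: asboolP => [->|/he ->]; last by rewrite raag_lift_gen.
  by rewrite raag_liftM // !raag_lift_gen.
have lV x : raag_lift h' x^-1 = (raag_lift h' x)^-1.
  apply/esym/mulg1_eq; rewrite -raag_liftM // mulgV.
  by rewrite (raag_lift_class c' [::]).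
have evE w : eval_word h w = raag_lift h' (eval_word merge w).
  elim: w => [|l w IH] /=; first by rewrite (raag_lift_class c' [::]).
  rewrite IH raag_liftM //; congr (_ * _); rewrite /eval_letter em -lV.
  by case: l.2.
split.
  by move=> u v /cm c; rewrite /commute !em -!raag_liftM // c.
move=> w; rewrite evE => ew; apply/fm/(free_on_inj free').
by rewrite ew (raag_lift_class c' [::]).
Qed.

End MergeFree.

(** * Families of disjoint cliques *)

Section CliqueFamilies.
Variable Gamma : graph.
Notation E := (extension_graph Gamma).
Implicit Types (x y : E) (s : seq E) (k : E -> Z).

Definition prodw k s : raag Gamma :=
  foldr (fun x g => zpow (val x) (k x) * g) 1 s.

(** The last field excludes the induced squares [a b c d] whose vertices all
    belong to the cliques and whose edge from [a] to [b] lies in one of them. *)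
Record clique_family (T : graph) (C : T -> seq E) : Prop := CliqueFamily {
  cf_nonempty : forall i, C i <> [::];
  cf_NoDup : forall i, List.NoDup (C i);
  cf_clique : forall i x y, List.In x (C i) -> List.In y (C i) ->
    x <> y -> adj x y;
  cf_disjoint : forall i j x, List.In x (C i) -> List.In x (C j) -> i = j;
  cf_adj : forall i j, adj i j <->
    i <> j /\ forall x y, List.In x (C i) -> List.In y (C j) -> adj x y;
  cf_square : forall i j l a b c d,
    List.In a (C i) -> List.In b (C i) -> List.In c (C j) -> List.In d (C l) ->
    adj a b -> adj b c -> adj c d -> adj d a ->
    a <> c -> b <> d -> ~ adj a c -> ~ adj b d -> False
}.

Section FamilyGraph.
Variables (I : Type) (C : I -> seq E).

Definition family_adj (i j : I) : Prop :=
  i <> j /\ forall x y, List.In x (C i) -> List.In y (C j) -> adj x y.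

Lemma family_adj_sym i j : family_adj i j -> family_adj j i.
Proof.
by move=> [ij aij]; split=> [|x y xj yi]; [exact: nesym|exact/adj_sym/aij].
Qed.

Lemma family_adj_irrefl i : ~ family_adj i i.
Proof. by case. Qed.

Definition family_graph : graph := Graph family_adj_sym family_adj_irrefl.

End FamilyGraph.

(** The clique at [z] is replaced by two, its first vertex [v] and the rest [s];
    the latter gets the index [None]. *)
Section Split.
Variables (T : graph) (C : T -> seq E) (z : T) (v : E) (s : seq E).
Hypothesis famC : clique_family C.
Hypothesis Cz : C z = v :: s.
Hypothesis s_nonempty : s <> [::].

Definition split_clique (i : option T) : seq E :=
  if i is Some j then if `[< j = z >] then [:: v] else C j else s.

Definition unsplit (i : option T) : T := if i is Some j then j else z.

Lemma split_cliqueS i x :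
  List.In x (split_clique i) -> List.In x (C (unsplit i)).
Proof.
case: i => [j|] /=; last by rewrite Cz; right.
by case: asboolP => // -> [<-|//]; rewrite Cz; left.
Qed.

Lemma split_clique_z : split_clique (Some z) = [:: v].
Proof. by rewrite /=; case: asboolP. Qed.

Lemma split_clique_neq j : j <> z -> split_clique (Some j) = C j.
Proof. by rewrite /=; case: asboolP. Qed.

Lemma v_notin_s : ~ List.In v s.
Proof. by have := cf_NoDup famC z; rewrite Cz => /List.NoDup_cons_iff[]. Qed.

Lemma split_disjoint i j x : List.In x (split_clique i) ->
  List.In x (split_clique j) -> i = j.
Proof.
move=> xi xj.
have := cf_disjoint famC (split_cliqueS xi) (split_cliqueS xj).
case: i j xi xj => [i|] [j|] //= xi xj e; first by rewrite e.
- move: xi; case: asboolP => // _ [e'|//]; by case: v_notin_s; rewrite e'.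
- move: xj; case: asboolP => [_|ne]; last by case: ne.
  by case=> [e'|//]; case: v_notin_s; rewrite e'.
Qed.

Lemma split_family : clique_family (T := family_graph split_clique) split_clique.
Proof.
split.
- case=> [i|//] /=; case: asboolP => // _; exact: cf_nonempty.
- case=> [i|] /=.
    case: asboolP => _; last exact: cf_NoDup.
    by constructor; [case|constructor].
  by have := cf_NoDup famC z; rewrite Cz => /List.NoDup_cons_iff[].
- by move=> i x y /split_cliqueS xi /split_cliqueS yi; apply: cf_clique xi yi.
- exact: split_disjoint.
- by [].
- move=> i j l a b c d /split_cliqueS ai /split_cliqueS bi /split_cliqueS cj
    /split_cliqueS dl; exact: (cf_square famC ai bi cj dl).
Qed.

(** An induced square in the graph of the split family that contains the edge
    between the two parts of the clique at [z] yields one in the extension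
    graph with an edge from [v] to [s]: its vertices other than [v] are those
    that witness the two missing adjacencies. *)
Lemma split_free (k : E -> Z) :
  free_on (T := family_graph split_clique) (fun i => prodw k (split_clique i)) ->
  free_on (fun i => prodw k (C i)).
Proof.
set T' := family_graph split_clique.
have vs y : List.In y s -> adj v y.
  move=> ys; apply: (cf_clique famC (i := z)); rewrite ?Cz; [by left|by right|].
  by move=> e; apply: v_notin_s; rewrite e.
have disj (p : T') x y : p <> Some z -> p <> None ->
    List.In x (C z) -> List.In y (split_clique p) -> x <> y.
  move=> pz pN xz yp e; have ez : unsplit p = z.
    by apply: (cf_disjoint famC (split_cliqueS yp)); rewrite -e.
  by move: ez pz pN; case: (p) => //= j ->.
have exna (p q : T') : p <> q -> ~ adj p q -> exists x y,
    [/\ List.In x (split_clique p), List.In y (split_clique q) & ~ adj x y].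
  move=> pq napq; apply: contrapT => H; apply: napq; split=> // x y xp yq.
  by apply: contrapT => naxy; apply: H; exists x, y.
move=> free'.
apply: (@free_on_merge T T' (Some z) None z Some _ _ _ _ _ _ _ _ _ free').
- split=> // x y; rewrite split_clique_z => -[<-|//]; exact: vs.
- by move=> i iz; split=> // -[].
- by move=> i j _ _ [].
- move=> i j iz jz; split=> [/(cf_adj famC)[ij aij]|[ij aij]].
    by split=> [[]//|]; rewrite !split_clique_neq.
  apply/(cf_adj famC); split; first by move=> e; apply: ij; rewrite e.
  by rewrite -split_clique_neq // -[C j]split_clique_neq.
- move=> i iz; split=> [/(cf_adj famC)[zi azi]|[[_ a1] [_ a2]]].
    split; split=> //.
    + by case=> /esym.
    + rewrite split_clique_z split_clique_neq // => x y [<-|//].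
      by apply: azi; rewrite Cz; left.
    + rewrite split_clique_neq // => x y xs; apply: azi; rewrite Cz; by right.
  apply/(cf_adj famC); split; first exact: nesym.
  rewrite split_clique_z split_clique_neq // in a1.
  rewrite split_clique_neq // in a2.
  by rewrite Cz => x y [<-|xs] yi; [apply: a1 => //; left|exact: a2].
- move=> p q [zp azp] nNp pN [Nq aNq] nzq qz apq.
  have [b [d [bs dp nbd]]] := exna None p (nesym pN) nNp.
  have [a [c [av cq nac]]] := exna (Some z) q (nesym qz) nzq.
  move: (av); rewrite split_clique_z => -[ea|//].
  have az : List.In a (C z) by rewrite Cz; left.
  have bz : List.In b (C z) by rewrite Cz; right.
  apply: (cf_square famC az bz (split_cliqueS cq) (split_cliqueS dp)) => //.
  + by rewrite -ea; exact: vs.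
  + exact: aNq.
  + by case: apq => _ apq; apply: adj_sym; exact: apq dp cq.
  + by apply: adj_sym; exact: azp av dp.
  + exact: (disj _ _ _ qz (nesym Nq) az cq).
  + exact: (disj _ _ _ (nesym zp) pN bz dp).
- by rewrite Cz split_clique_z /= mulg1.
- by move=> i iz; rewrite split_clique_neq.
Qed.

End Split.

(** When [l] enumerates [T] without repetition, this is the number of splittings
    that reduce all the cliques to single vertices. *)
Definition excess (T : Type) (C : T -> seq E) (l : seq T) : nat :=
  sumn [seq (size (C i)).-1 | i <- l].

Lemma excess_split (T : graph) (C : T -> seq E) z v s l :
  C z = v :: s -> s <> [::] -> List.In z l ->
  excess (split_clique C z v s) (None :: map Some l) < excess C l.
Proof.
move=> Cz; case: s Cz => // y s Cz _ zl; rewrite /excess /= -map_comp.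
suff : sumn [seq (size (split_clique C z v (y :: s) (Some i))).-1 | i <- l]
    + size (y :: s) <= sumn [seq (size (C i)).-1 | i <- l].
  by rewrite /= addnS addnC.
have le i : (size (split_clique C z v (y :: s) (Some i))).-1 <= (size (C i)).-1.
  by rewrite /=; case: asboolP.
have lel l' : sumn [seq (size (split_clique C z v (y :: s) (Some i))).-1 | i <- l']
    <= sumn [seq (size (C i)).-1 | i <- l'].
  by elim: l' => //= i l' IH; apply: leq_add => //; exact: le.
elim: l zl => // i l IH [->|zl].
  rewrite [X in X + _ <= _]/= [X in _ <= X]/= Cz; case: asboolP => // _.
  by rewrite add0n addnC leq_add.
by rewrite [X in X + _ <= _]/= [X in _ <= X]/= -addnA;
  apply: leq_add; [exact: le|exact: IH].
Qed.

Lemma family_free (U : E -> Prop) (k : E -> Z) (B : Z) :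
  (forall x, U x -> Z.abs (ext_height x 1%g) <= B)%Z ->
  (forall x y, U x -> U y -> x <> y -> ~ adj x y -> forall g,
     Z.abs (ext_height x g) <= B \/ Z.abs (ext_height y g) <= B)%Z ->
  (forall x, U x -> 2 * B < Z.abs (k x))%Z ->
  forall (T : graph) (C : T -> seq E) (l : seq T),
  (forall i, List.In i l) -> (forall i x, List.In x (C i) -> U x) ->
  clique_family C -> free_on (fun i => prodw k (C i)).
Proof.
move=> U1 Ufar Uk.
have base (T : graph) (C : T -> seq E) : (forall i x, List.In x (C i) -> U x) ->
    clique_family C -> ~ (exists z v s, C z = v :: s /\ s <> [::]) ->
    free_on (fun i => prodw k (C i)).
  move=> CU fam ns.
  have [e eE] : exists e : T -> E, forall i, C i = [:: e i].
    suff /choice[e eE] : forall i, exists x, C i = [:: x] by exists e.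
    move=> i; case e: (C i) => [|x [|y s]].
    + by case: (cf_nonempty fam e).
    + by exists x.
    + by case: ns; exists i, x, (y :: s).
  have -> : (fun i => prodw k (C i)) = (fun i => zpow (val (e i)) (k (e i))).
    by apply/funext => i; rewrite eE /= mulg1.
  have eU i : U (e i) by apply: (CU i); rewrite eE; left.
  apply: (@powers_free _ _ e _ B).
  + by move=> i j eij; apply: (cf_disjoint fam (x := e i)); rewrite eE ?eij; left.
  + move=> i j; split=> [/(cf_adj fam)[_]|aij].
      by apply; rewrite eE; left.
    apply/(cf_adj fam); split.
      by move=> e'; move: aij; rewrite e'; exact: adj_irrefl.
    by move=> x y; rewrite !eE => -[<-|//] [<-|//].
  + by move=> i; exact: U1.
  + by move=> i j; exact: Ufar.
  + by move=> i; exact: Uk.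
move=> T C l; move: {2}(excess C l) (leqnn (excess C l)) => n.
elim: n T C l => [|n IH] T C l ex lT CU fam.
all: have [[z [v [s [Cz sN]]]]|ns] :=
  pselect (exists z v s, C z = v :: s /\ s <> [::]); last exact: base.
all: have lt := leq_trans (excess_split Cz sN (lT z)) ex.
- by rewrite ltn0 in lt.
- apply: (split_free fam Cz).
  apply: (IH (family_graph (split_clique C z v s)) _ (None :: map Some l)).
  + by rewrite -ltnS.
  + by case=> [i|]; [right; apply: List.in_map|left].
  + by move=> i x /(split_cliqueS Cz); exact: CU.
  + exact: split_family.
Qed.

End CliqueFamilies.

Lemma finite_set_list (T : Type) (A : set T) : finite_set A ->
  exists s : seq T, List.NoDup s /\ forall x, List.In x s <-> A x.
Proof.
move=> /(@finite_seqP {classic T})[s ->]; exists (undup s).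
have InE (r : seq {classic T}) x : List.In x r <-> x \in r.
  elim: r => [|y r IH] //=; rewrite in_cons; split.
    by case=> [->|/IH ->]; rewrite ?eqxx ?orbT.
  by case/orP => [/eqP ->|/IH]; [left|right].
split=> [|x]; last by rewrite InE mem_undup.
elim: s => [|x s IH] /=; first by constructor.
case: ifP => // xs; constructor=> // /InE; rewrite mem_undup xs.
by [].
Qed.

Lemma list_bound (A : Type) (P : A -> Z -> Prop) :
  (forall a c d, P a c -> (c <= d)%Z -> P a d) -> (forall a, exists c, P a c) ->
  forall l, exists c, forall a, List.In a l -> P a c.
Proof.
move=> Pmono Pex; elim=> [|a l [c IH]]; first by exists 0%Z.
have [d Pd] := Pex a; exists (Z.max c d) => b [<-|bl].
  by apply: Pmono Pd _; lia.
by apply: Pmono (IH b bl) _; lia.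
Qed.

(** * Elements whose support is generated by a clique *)

Section Supports.
Variable Gamma : graph.
Notation E := (extension_graph Gamma).
Implicit Types (x y : E) (s : seq E) (k : E -> Z).

Definition commuting s : Prop :=
  forall x y, List.In x s -> List.In y s -> commute (val x) (val y).

Lemma commuting_tail x s : commuting (x :: s) -> commuting s.
Proof. by move=> cs y z ys zs; apply: cs; right. Qed.

Lemma prodw_commute k s g :
  (forall x, List.In x s -> commute g (val x)) -> commute g (prodw k s).
Proof.
elim: s => [_|x s IH cg] /=; first exact: commute1.
apply: commuteM; last by apply: IH => y ys; apply: cg; right.
by apply/commute_sym/zpow_commute/commute_sym/cg; left.
Qed.

Lemma prodwD k j s : commuting s ->
  prodw (fun x => (k x + j x)%Z) s = prodw k s * prodw j s.
Proof.
elim: s => [_|x s IH cs] /=; first by rewrite mulg1.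
rewrite IH; last exact: commuting_tail cs.
rewrite zpowD -!mulgA; congr (_ * _); rewrite !mulgA; congr (_ * _).
apply: prodw_commute => y ys; apply/zpow_commute; apply: cs; [by left|by right].
Qed.

Lemma prodw_eq k j s : (forall x, List.In x s -> k x = j x) ->
  prodw k s = prodw j s.
Proof.
elim: s => //= x s IH kj; rewrite kj; last by left.
by congr (_ * _); apply: IH => y ys; apply: kj; right.
Qed.

Lemma prodw0 s : prodw (fun=> 0%Z) s = 1.
Proof. by elim: s => //= x s ->; rewrite mulg1. Qed.

Lemma prodwX k s n : commuting s ->
  prodw k s ^+ n = prodw (fun x => (Z.of_nat n * k x)%Z) s.
Proof.
move=> cs; elim: n => [|n IH].
  by rewrite expg0 -[LHS](prodw0 s); apply: prodw_eq => x _; lia.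
by rewrite expgS IH -prodwD //; apply: prodw_eq => x _; lia.
Qed.

Lemma generated_prodw s g : List.NoDup s -> commuting s ->
  generated [set val x | x in [set x | List.In x s]] g ->
  exists k, g = prodw k s.
Proof.
move=> ds cs; move: g; apply: generated_ind.
- by exists (fun=> 0%Z); rewrite prodw0.
- by move=> _ _ [k ->] [j ->]; exists (fun x => (k x + j x)%Z); rewrite prodwD.
- move=> _ [k ->]; exists (fun x => (- k x)%Z); apply: mulg1_eq.
  rewrite -prodwD // -[RHS](prodw0 s); apply: prodw_eq => x _; lia.
- move=> _ [x xs <-].
  exists (fun y => if `[< y = x >] then 1%Z else 0%Z).
  elim: s xs ds {cs} => //= y s IH xs /List.NoDup_cons_iff[nys ds].
  case: asboolP => [eyx|nyx].
    rewrite eyx (@prodw_eq _ (fun=> 0%Z)) ?prodw0 ?mulg1 ?expg1 //=.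
    by move=> w ws; case: asboolP => // ewx; case: nys; rewrite eyx -ewx.
  by case: xs => [//|xs]; rewrite mul1g; exact: IH.
Qed.

Lemma generated_zpow (G : groupType) (A : set G) (g : G) n :
  generated A g -> generated A (zpow g n).
Proof.
move=> Ag; have pos m : generated A (g ^+ m).
  elim: m => [|m IH]; first exact: generated1.
  by rewrite expgS; exact: generatedM.
case: n => [|p|p] /=; [exact: generated1|exact: pos|].
by apply: generatedV; exact: pos.
Qed.

Lemma prodw_conj_set k s (g : raag Gamma) (A : set (raag Gamma)) :
  (forall x, List.In x s -> k x <> 0%Z -> conj_set g (generated A) (val x)) ->
  conj_set g (generated A) (prodw k s).
Proof.
elim: s => [_|x s IH Hs] /=.
  by exists 1; [exact: generated1|rewrite mulg1 mulgV].
have [|t At et] := IH; first by move=> y ys; apply: Hs; right.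
have [q Aq eq] : conj_set g (generated A) (zpow (val x) (k x)).
  have [k0|k0] := pselect (k x = 0%Z).
    by rewrite k0; exists 1; [exact: generated1|rewrite mulg1 mulgV].
  have [|q Aq <-] := Hs x _ k0; first by left.
  by rewrite zpow_conj; exists (zpow q (k x)) => //; exact: generated_zpow.
exists (q * t); first exact: generatedM.
by rewrite -eq -et !mulgA mulgVK.
Qed.

(** If the exponent of a vertex [x = g a g^-1] of the clique were zero, then the
    element would lie in the conjugate of A(link a) by [g], which contains all
    the other vertices of the clique; but this parabolic subgroup does not
    contain [x]. *)
Lemma support_prodw s g : List.NoDup s ->
  (forall x y, List.In x s -> List.In y s -> x <> y -> adj x y) ->
  is_support g (generated [set val x | x in [set x | List.In x s]]) ->
  exists k, g = prodw k s /\ forall x, List.In x s -> k x <> 0%Z.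
Proof.
move=> ds cls [_ Pg minP].
have cs : commuting s.
  move=> x y xs ys; have [->|nxy] := pselect (x = y); first exact: commute_refl.
  by have [] := cls x y xs ys nxy.
have [k eg] := generated_prodw ds cs Pg.
exists k; split=> // x xs kx0.
pose Q := conj_set (rep x).1 (standard_subgroup (link (rep x).2)).
have parQ : parabolic Q by exists (rep x).1, (link (rep x).2).
have Qg : Q g.
  rewrite eg; apply: prodw_conj_set => y ys ky0.
  have nyx : y <> x by move=> eyx; apply: ky0; rewrite eyx.
  by have [t Lt ->] := adj_link (cls y x ys xs nyx); exists t.
have : Q (val x) by apply: (minP Q parQ Qg); apply: generated_gen; exists x.
move=> [t Lt]; rewrite repE => /mulIg/mulgI et.
have := height_link 1 Lt; rewrite et.
have := height_zpow (rep x).2 1 1.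
by rewrite /= expg1 => ->; lia.
Qed.

End Supports.

(** * The theorem *)

Lemma square_adjE (i j : 'I_4) :
  square_adj i j <-> val j = (val i).+1 %% 4 \/ val i = (val j).+1 %% 4.
Proof.
split=> -[e|e]; [left|right|left|right]; rewrite ?e //; exact: val_inj.
Qed.

Lemma square_embedding (T : graph) (a b c d : T) :
  adj a b -> adj b c -> adj c d -> adj d a ->
  a <> c -> b <> d -> ~ adj a c -> ~ adj b d ->
  induced_embedding (fun i : square_graph => nth a [:: a; b; c; d] (i : 'I_4)).
Proof.
move=> ab bc cd da nac nbd ac bd.
have [ba cb dc ad] := And4 (adj_sym ab) (adj_sym bc) (adj_sym cd) (adj_sym da).
have [nab nbc ncd nda] := And4 (adj_neq ab) (adj_neq bc) (adj_neq cd) (adj_neq da).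
have [nba ncb ndc nad] := And4 (adj_neq ba) (adj_neq cb) (adj_neq dc) (adj_neq ad).
have [nca ndb ca db] := And4 (nesym nac) (nesym nbd)
  (fun h => ac (adj_sym h)) (fun h => bd (adj_sym h)).
have irr := @adj_irrefl T.
split.
  by move=> [[|[|[|[|i]]]] li] [[|[|[|[|j]]]] lj] //= e; apply: val_inj.
move=> [[|[|[|[|i]]]] li] [[|[|[|[|j]]]] lj] //=.
all: split=> [h|/square_adjE /= []] //.
all: try by case: (irr _ h).
all: by apply/square_adjE => /=; try (by left); right.
Qed.

Lemma enum_list (T : Type) (A : set T) : finite_set A ->
  exists l : seq (set_type A), forall K, List.In K l.
Proof.
move=> /finite_set_list[dl [_ dlP]].
pose f (K : T) : seq (set_type A) :=
  if pselect (A K) is left AK then [:: SigSub (mem_set AK)] else [::].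
exists (List.flat_map f dl) => K; apply/List.in_flat_map; exists (val K).
have AK : A (val K) by apply: set_mem; exact: valP.
split; first exact/dlP.
by rewrite /f; case: pselect => // AK'; left; exact: val_inj.
Qed.

Lemma ext_height_bound (Gamma : graph) (lu : seq (extension_graph Gamma)) :
  exists B, [/\ (0 <= B)%Z,
    forall x, List.In x lu -> (Z.abs (ext_height x 1%g) <= B)%Z &
    forall x y, List.In x lu -> List.In y lu -> x <> y -> ~ adj x y ->
      forall g, (Z.abs (ext_height x g) <= B \/ Z.abs (ext_height y g) <= B)%Z].
Proof.
have [|x|B1 HB1] := @list_bound _ (fun x c => Z.abs (ext_height x 1%g) <= c)%Z _ _ lu.
- by move=> a c d; lia.
- by exists (Z.abs (ext_height x 1%g)); lia.
have [||B2 HB2] := @list_bound _ (fun x c => forall y, List.In y lu -> x <> y ->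
    ~ adj x y -> forall g,
    Z.abs (ext_height x g) <= c \/ Z.abs (ext_height y g) <= c)%Z _ _ lu.
- by move=> a c d H cd y yl ay nay g; have := H y yl ay nay g; lia.
- move=> x; apply: (@list_bound _ (fun y c => x <> y -> ~ adj x y ->
    forall g, Z.abs (ext_height x g) <= c \/ Z.abs (ext_height y g) <= c)%Z _ _ lu).
    by move=> a c d H cd xa nxa g; have := H xa nxa g; lia.
  move=> y; have [[xy nxy]|h] := pselect (x <> y /\ ~ adj x y); last first.
    by exists 0%Z => xy nxy; case: h.
  have [C HC] := ext_height_far xy nxy.
  by exists C => _ _ g; have := HC g; lia.
exists (Z.max 0 (Z.max B1 B2)); split; first lia.
  by move=> x /HB1; lia.
by move=> x y xl yl xy nxy g; have := HB2 x xl y yl xy nxy g; lia.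
Qed.

Theorem theorem6p2 (Gamma : graph)
    (D : set (clique_graph (extension_graph Gamma)))
    (finD : finite_set D)
    (disjD : forall K L : clique_graph (extension_graph Gamma),
       D K -> D L -> K <> L -> clique_set K `&` clique_set L = set0)
    (squareD : forall s : square_graph -> extension_graph Gamma,
       induced_embedding s ->
       (exists i, forall K, D K -> ~ clique_set K (s i)) \/
       (forall i j, adj (s i) (s j) ->
          forall K, D K -> ~ (clique_set K (s i) /\ clique_set K (s j)))) :
  exists M : nat, (0 < M)%N /\
    forall g : induced D -> raag Gamma,
      (forall K : induced D, is_support (g K) (clique_subgroup (val K))) ->
      exists f : {multiplicative raag (induced D) -> raag Gamma},
        injective f /\
        forall K : induced D, f (raag_gen K) = g K ^+ M.
Proof.
have DK (K : induced D) : D (val K) by apply: set_mem; exact: (valP K).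
have cliqueK (K : induced D) :
    [/\ finite_set (clique_set (val K)), clique_set (val K) !=set0
      & clique (clique_set (val K))].
  by apply: set_mem; exact: (valP (val K)).
have /choice[C CP] : forall K : induced D, exists s : seq (extension_graph Gamma),
    List.NoDup s /\ forall x, List.In x s <-> clique_set (val K) x.
  by move=> K; have [finK _ _] := cliqueK K; exact: finite_set_list.
have InC K x : List.In x (C K) <-> clique_set (val K) x := (CP K).2 x.
have Cdisj (K L : induced D) x : List.In x (C K) -> List.In x (C L) -> K = L.
  move=> /InC xK /InC xL; apply: contrapT => nKL.
  have : (clique_set (val K) `&` clique_set (val L)) x by split.
  by rewrite disjD //; move=> e; apply: nKL; exact: val_inj.
have fam : clique_family (T := induced D) C.
  split.
  - move=> K; have [_ [x /InC xK] _] := cliqueK K.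
    by move=> e; rewrite e in xK.
  - by move=> K; exact: (CP K).1.
  - by move=> K x y /InC xK /InC yK; have [_ _] := cliqueK K; apply.
  - exact: Cdisj.
  - move=> K L; split=> [[nKL [Q [clQ KQ LQ]]]|[nKL aKL]].
      split; first by move=> e; apply: nKL; rewrite e.
      move=> x y xK yL; apply: clQ; [exact/KQ/InC|exact/LQ/InC|].
      move=> exy; apply: nKL; congr val; apply: (Cdisj _ _ x) => //.
      by rewrite exy.
    split; first by move=> e; apply: nKL; exact: val_inj.
    exists (clique_set (val K) `|` clique_set (val L)); split.
    + move=> x y [xK|xL] [yK|yL] nxy.
      * by have [_ _] := cliqueK K; apply.
      * by apply: aKL; apply/InC.
      * by apply: adj_sym; apply: aKL; apply/InC.
      * by have [_ _] := cliqueK L; apply.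
    + by move=> x; left.
    + by move=> x; right.
  - move=> K L N a b c d /InC aK /InC bK /InC cL /InC dN ab bc cd da ac bd nac nbd.
    have sq := square_embedding ab bc cd da ac bd nac nbd.
    case: (squareD _ sq) => [[[[|[|[|[|i]]]] li] H]|H] //=.
    + exact: (H (val K)).
    + exact: (H (val K)).
    + exact: (H (val L)).
    + exact: (H (val N)).
    + apply: (H (@Ordinal 4 0 isT) (@Ordinal 4 1 isT) _ (val K)) => //.
have [l lP] := enum_list finD.
pose U x := exists K : induced D, List.In x (C K).
have Ulist x : U x -> List.In x (List.flat_map C l).
  by move=> [K xK]; apply/List.in_flat_map; exists K.
have [B [B0 Bone Bfar]] := ext_height_bound (List.flat_map C l).
(* A non-zero integer times M exceeds 2B in absolute value. *)
pose M := Z.to_nat (2 * B + 1); exists M; split; first by apply/ltP; lia.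
move=> g supp_g.
have /choice[k kP] : forall K : induced D, exists k,
    g K = prodw k (C K) /\ forall x, List.In x (C K) -> k x <> 0%Z.
  move=> K; apply: support_prodw; first exact: (CP K).1.
    exact: (cf_clique fam).
  have -> : [set x | List.In x (C K)] = clique_set (val K).
    by apply/seteqP; split=> x /InC.
  exact: supp_g.
(* As the cliques are disjoint, the exponents for the different cliques form a
   single function on vertices. *)
pose w x := if pselect (U x) is left Ux then
  (Z.of_nat M * k (projT1 (cid Ux)) x)%Z else 0%Z.
have wE K x : List.In x (C K) -> w x = (Z.of_nat M * k K x)%Z.
  move=> xK; rewrite /w; case: pselect => [Ux|[]]; last by exists K.
  by rewrite (Cdisj _ _ _ (projT2 (cid Ux)) xK).
have free : free_on (fun K : induced D => prodw w (C K)).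
  apply: (@family_free _ U w B _ _ _ (induced D) C l) => //.
  - by move=> x /Ulist; exact: Bone.
  - by move=> x y /Ulist xl /Ulist; exact: Bfar.
  - move=> x [K xK]; rewrite (wE K) //; have := (kP K).2 x xK.
    by rewrite /M; nia.
  - by move=> K x xK; exists K.
pose h (K : induced D) := prodw w (C K).
have hE K : h K = g K ^+ M.
  rewrite (kP K).1 prodwX; first by apply: prodw_eq => x /wE.
  move=> x y xK yK; have [->|nxy] := pselect (x = y); first exact: commute_refl.
  by have [] := cf_clique fam xK yK nxy.
pose f : {multiplicative raag (induced D) -> raag Gamma} :=
  HB.pack (raag_lift h) (isMultiplicative.Build _ _ _ (raag_liftM free.1)).
exists f; split; first exact: free_on_inj free.
by move=> K; rewrite -hE; exact: (raag_lift_gen free.1).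
Qed.
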